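(* Let $(\Omega,\mathcal{F})$ be a measurable space, $T:\Omega\to\Omega$ measurable, and $V$ a $T$-invariant upper probability. Then $V$ is weakly mixing if and only if there exists $Q\in\mathcal{M}^{wm}(T)\cap\operatorname{core}(V)$ such that for every $P\in\operatorname{core}(V)$, $P(A)=Q(A)$ for all $A\in\mathcal{I}$. Moreover, such a $Q$ is unique.
   Context: A capacity is a monotone map $\mu:\mathcal{F}\to[0,1]$ with $\mu(\emptyset)=0,\mu(\Omega)=1$. An upper probability is a capacity $V$ with $V(A)=\max_{P\in\Lambda}P(A)$ for a weak* (setwise convergence) compact set $\Lambda$ of probabilities; $\operatorname{core}(V)$ is the set of finitely additive normalized $P\le V$. $V$ is $T$-invariant if $V(T^{-1}A)=V(A)$ for all $A$; $\mathcal{I}=\{A:T^{-1}A=A\}$. A $T$-invariant capacity $\mu$ is weakly mixing if every $\mathcal{F}$-measurable $f:\Omega\to\mathbb{C}$ satisfying $f\circ T=\lambda f$ $\mu$-a.s. for some $\lambda\in\mathbb{C}$ is constant $\mu$-a.s. (a property holds $\mu$-a.s. if it holds on $A\in\mathcal{F}$ with $\mu(A^c)=0$). $\mathcal{M}^{wm}(T)$ is the set of $T$-invariant probabilities $P$ that are weakly mixing, i.e. $P\times P$ is ergodic for $T\times T$ (every $T\times T$-invariant set has $P\times P$-measure $0$ or $1$). *)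

(* Defs.v *)
From HB Require Import structures.
From mathcomp Require Import all_boot all_order all_algebra.
From mathcomp Require Import all_classical all_reals all_analysis.
From mathcomp Require Import complex.

Set Implicit Arguments.
Unset Strict Implicit.
Unset Printing Implicit Defensive.

Import Order.TTheory GRing.Theory Num.Theory.
Import numFieldNormedType.Exports.
Local Open Scope classical_set_scope.
Local Open Scope ring_scope.

Section Defs.
Context {d : measure_display} {Omega : measurableType d} {R : realType}.

Definition capacity (mu : set Omega -> R) : Prop :=
  mu set0 = 0 /\ mu setT = 1 /\
  (forall A B, measurable A -> measurable B -> A `<=` B -> mu A <= mu B).

(* Embedding of a probability into the space of set functions, equipped with
   the topology of pointwise (= setwise) convergence on measurable sets;
   the value on non-measurable sets is frozen to 0. *)
Definition setwise_eval (P : probability Omega R) : {ptws set Omega -> R} :=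
  fun A => if `[< measurable A >] then fine (P A) else 0.

(* Lambda is compact for the weak* (setwise convergence) topology:
   this topology is the initial topology of setwise_eval. *)
Definition setwise_compact (Lambda : set (probability Omega R)) : Prop :=
  compact (setwise_eval @` Lambda).

Definition upper_probability (V : set Omega -> R) : Prop :=
  capacity V /\
  exists Lambda : set (probability Omega R),
    setwise_compact Lambda /\
    forall A, measurable A ->
      (exists2 P, Lambda P & fine (P A) = V A) /\
      (forall P, Lambda P -> fine (P A) <= V A).

Definition core (V : set Omega -> R) : set (set Omega -> R) :=
  [set P | P setT = 1 /\
           (forall A, measurable A -> 0 <= P A) /\
           (forall A B, measurable A -> measurable B -> [disjoint A & B] ->
              P (A `|` B) = P A + P B) /\
           (forall A, measurable A -> P A <= V A)].

Definition cap_T_invariant (T : Omega -> Omega) (V : set Omega -> R) : Prop :=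
  forall A, measurable A -> V (T @^-1` A) = V A.

Definition invariant_set (T : Omega -> Omega) (A : set Omega) : Prop :=
  measurable A /\ T @^-1` A = A.

Definition cap_as (mu : set Omega -> R) (p : Omega -> Prop) : Prop :=
  exists A, measurable A /\ mu (~` A) = 0 /\ forall x, A x -> p x.

Definition cmeasurable (f : Omega -> R[i]) : Prop :=
  measurable_fun setT (fun x => complex.Re (f x)) /\
  measurable_fun setT (fun x => complex.Im (f x)).

Definition cap_weakly_mixing (T : Omega -> Omega) (mu : set Omega -> R) : Prop :=
  forall (f : Omega -> R[i]) (lam : R[i]), cmeasurable f ->
    cap_as mu (fun x => f (T x) = lam * f x) ->
    exists c : R[i], cap_as mu (fun x => f x = c).

Definition prob_weakly_mixing (T : Omega -> Omega) (P : probability Omega R) : Prop :=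
  (forall A, measurable A -> P (T @^-1` A) = P A) /\
  (forall E : set (Omega * Omega), measurable E ->
     (fun z => (T z.1, T z.2)) @^-1` E = E ->
     ((P \x P)%E E = 0%E \/ (P \x P)%E E = 1%E)).

End Defs.

(* Main.v *)
Require Import Defs.
From HB Require Import structures.
From mathcomp Require Import all_boot all_order all_algebra.
From mathcomp Require Import all_classical all_reals all_analysis.
From mathcomp Require Import measurable_realfun complex.
From mathcomp Require Import ring lra zify.

Import Order.TTheory GRing.Theory Num.Theory.
Import numFieldNormedType.Exports.
Local Open Scope classical_set_scope.
Local Open Scope ring_scope.

Set Implicit Arguments.
Unset Strict Implicit.
Unset Printing Implicit Defensive.

(** A set function dominated by an upper probability [V] is continuous at the
empty set, so Cesaro averages along an ultrafilter give an invariant probability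
[Q] in the core.  Weak mixing of [V] makes [V] 0-1 on invariant sets, hence all
of the core agrees there, and it leaves [Q] without nonconstant eigenfunctions.

Such a [Q] is weakly mixing.  If [E] were invariant under [T x T] with
[0 < a = (Q x Q)(E) < 1], the kernel [k = 1_E - a] has zero marginals, and
[K = k k^T] is symmetric, invariant, nonzero and orthogonal to constants.  With
[rho] the top eigenvalue of [K^2], the iterates [K^(2n) / rho^n] are Cauchy in
[L^2(Q x Q)], hence converge uniformly to an invariant projection kernel [P].
The trace of [P] bounds its rank, so [P] is a finite-dimensional reproducing
kernel on whose range [T] acts by an invertible matrix; an eigenvector of this
matrix is a nonconstant eigenfunction.

Conversely, if [f o T = lam f] off a [V]-null set, then [f y / f x] is invariant
under [T x T] off a null set, so [f] is [Q]-a.s. constant; the set where it is not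
is invariant up to a [V]-null set, and [V] and [Q] agree on invariant sets.

Uniqueness: the sets maximizing [Q1 - Q2] include an invariant one. *)

(** * Means of bounded measurable functions *)

Section BoundedMeasurable.
Context {R : realType}.

(** This class is stable under sums, products and partial means, and is integrable for every
    probability, so integrability never has to be tracked. *)
Definition bmfun d (X : measurableType d) (f : X -> R) : Prop :=
  measurable_fun setT f /\ exists M : R, forall x, `|f x| <= M.

Section Closure.
Context d (X : measurableType d).
Implicit Types f g : X -> R.

Lemma bmfun_cst r : bmfun (fun _ : X => r).
Proof. by split; [exact: measurable_cst | exists `|r|]. Qed.

Lemma bmfunD f g : bmfun f -> bmfun g -> bmfun (fun x => f x + g x).
Proof.
move=> [mf [M fM]] [mg [N gN]]; split; first exact: measurable_funD.
by exists (M + N) => x; rewrite (le_trans (ler_normD _ _))// lerD.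
Qed.

Lemma bmfunM f g : bmfun f -> bmfun g -> bmfun (fun x => f x * g x).
Proof.
move=> [mf [M fM]] [mg [N gN]]; split; first exact: measurable_funM.
by exists (M * N) => x; rewrite normrM ler_pM.
Qed.

Lemma bmfunZ r f : bmfun f -> bmfun (fun x => r * f x).
Proof. by move=> bf; apply: bmfunM => //; exact: bmfun_cst. Qed.

Lemma bmfunB f g : bmfun f -> bmfun g -> bmfun (fun x => f x - g x).
Proof.
move=> bf /(bmfunZ (-1)) /(bmfunD bf); congr bmfun.
by apply/funext => x; rewrite mulN1r.
Qed.

Lemma bmfun_comp d' (Y : measurableType d') (h : Y -> X) f :
  measurable_fun setT h -> bmfun f -> bmfun (fun y => f (h y)).
Proof.
move=> mh [mf [M fM]]; split; last by exists M.
exact: measurableT_comp.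
Qed.

Lemma bmfun_sum n (F : 'I_n -> X -> R) : (forall i, bmfun (F i)) ->
  bmfun (fun x => \sum_(i < n) F i x).
Proof.
elim: n F => [|n IH] F bF.
  have -> : (fun x => \sum_(i < 0) F i x) = (fun=> 0).
    by apply/funext => x; rewrite big_ord0.
  exact: bmfun_cst.
have -> : (fun x => \sum_(i < n.+1) F i x) =
    (fun x => \sum_(i < n) F (widen_ord (leqnSn n) i) x + F ord_max x).
  by apply/funext => x; rewrite big_ord_recr.
by apply: bmfunD => //; exact: IH.
Qed.

Lemma bmfun_indic (E : set X) : measurable E -> bmfun (\1_E : X -> R).
Proof.
move=> mE; split; first exact: measurable_indic.
by exists 1 => x; rewrite indicE; case: (x \in E); rewrite ?normr1 ?normr0.
Qed.

End Closure.

Section Integral.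
Context d (X : measurableType d) (mu : probability X R).
Implicit Types f g : X -> R.

Lemma bmfun_integrable f : bmfun f -> mu.-integrable setT (EFin \o f).
Proof.
move=> [mf [M fM]]; apply: measurable_bounded_integrable => //.
  by rewrite (le_lt_trans (probability_le1 mu measurableT))// ltry.
exists M; split; first exact: num_real.
by move=> N MN x _ /=; rewrite (le_trans (fM x))// ltW.
Qed.

Definition mean f : R := \int[mu]_x f x.

Lemma meanD f g : bmfun f -> bmfun g ->
  mean (fun x => f x + g x) = mean f + mean g.
Proof. by move=> bf bg; rewrite /mean RintegralD//; exact: bmfun_integrable. Qed.

Lemma meanB f g : bmfun f -> bmfun g ->
  mean (fun x => f x - g x) = mean f - mean g.
Proof. by move=> bf bg; rewrite /mean RintegralB//; exact: bmfun_integrable. Qed.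

Lemma meanZ r f : bmfun f -> mean (fun x => r * f x) = r * mean f.
Proof. by move=> bf; rewrite /mean RintegralZl//; exact: bmfun_integrable. Qed.

Lemma meanZr r f : bmfun f -> mean (fun x => f x * r) = mean f * r.
Proof. by move=> bf; rewrite /mean RintegralZr//; exact: bmfun_integrable. Qed.

Lemma mean_cst r : mean (fun=> r) = r.
Proof. by rewrite /mean Rintegral_cst//= probability_setT mulr1. Qed.

Lemma mean_ge0 f : (forall x, 0 <= f x) -> 0 <= mean f.
Proof. by move=> f0; exact: Rintegral_ge0. Qed.

Lemma le_mean f g : bmfun f -> bmfun g -> (forall x, f x <= g x) ->
  mean f <= mean g.
Proof. by move=> bf bg fg; apply: le_Rintegral => //; exact: bmfun_integrable. Qed.

Lemma eq_mean f g : f =1 g -> mean f = mean g.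
Proof. by move=> fg; congr mean; exact/funext. Qed.

Lemma mean_sum n (F : 'I_n -> X -> R) : (forall i, bmfun (F i)) ->
  mean (fun x => \sum_(i < n) F i x) = \sum_(i < n) mean (F i).
Proof.
elim: n F => [|n IH] F bF.
  by under eq_mean do rewrite big_ord0; rewrite big_ord0 mean_cst.
under eq_mean do rewrite big_ord_recr/=.
rewrite big_ord_recr/= meanD//; last exact: bmfun_sum.
by rewrite IH.
Qed.

Lemma norm_mean_le f M : bmfun f -> (forall x, `|f x| <= M) -> `|mean f| <= M.
Proof.
move=> bf fM; rewrite ler_norml; apply/andP; split.
  rewrite -(mean_cst (- M)); apply: le_mean => //; first exact: bmfun_cst.
  by move=> x; have := fM x; rewrite ler_norml => /andP[].
rewrite -[leRHS](mean_cst M); apply: le_mean => //; first exact: bmfun_cst.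
by move=> x; have := fM x; rewrite ler_norml => /andP[].
Qed.

(* Nonnegativity of the mean of (b f - a g)^2, with a = E[fg] and b = E[g^2]. *)
Lemma mean_CauchySchwarz f g : bmfun f -> bmfun g ->
  mean (fun x => f x * g x) ^+ 2 <=
  mean (fun x => f x ^+ 2) * mean (fun x => g x ^+ 2).
Proof.
move=> bf bg.
set a := mean (fun x => f x * g x).
set b := mean (fun x => g x ^+ 2); set c := mean (fun x => f x ^+ 2).
have bff : bmfun (fun x => f x ^+ 2) by exact: bmfunM.
have bgg : bmfun (fun x => g x ^+ 2) by exact: bmfunM.
have bfg : bmfun (fun x => f x * g x) by exact: bmfunM.
have key s t : 0 <= s ^+ 2 * c - 2 * s * t * a + t ^+ 2 * b.
  rewrite /a /b /c -!meanZ// -meanB; try exact: bmfunZ.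
  rewrite -meanD; [|by apply: bmfunB; exact: bmfunZ|exact: bmfunZ].
  apply: mean_ge0 => x.
  rewrite (_ : _ + _ = (s * f x - t * g x) ^+ 2) ?sqr_ge0//; ring.
have b0 : 0 <= b by apply: mean_ge0 => x; exact: sqr_ge0.
have := key b a.
rewrite (_ : _ + _ = b * (c * b - a ^+ 2)); last by ring.
have [b0' _|bN0] := eqVneq b 0.
  have c0 : 0 <= c by apply: mean_ge0 => x; exact: sqr_ge0.
  have := key a (c + 1); rewrite b0' mulr0 addr0.
  have : 0 <= a ^+ 2 by exact: sqr_ge0.
  nra.
by rewrite pmulr_rge0 ?lt_neqAle 1?eq_sym ?bN0// subr_ge0.
Qed.

End Integral.

Section Ae.
Context d (X : measurableType d) (mu : probability X R).

Lemma eq_mean_negligible (f g : X -> R) : bmfun f -> bmfun g ->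
  mu.-negligible [set x | f x != g x] -> mean mu f = mean mu g.
Proof.
move=> [mf _] [mg _] fg; congr fine; apply: ae_eq_integral => //.
- exact/measurable_EFinP.
- exact/measurable_EFinP.
- apply: negligibleS fg => x /= /not_implyP[_ fgx]; apply/eqP => fgx'.
  by apply: fgx; rewrite fgx'.
Qed.

End Ae.

Section Fubini.
Context d1 d2 (X : measurableType d1) (Y : measurableType d2).
Context (mu : probability X R) (nu : probability Y R).

Lemma bmfun_section (h : X * Y -> R) x : bmfun h -> bmfun (fun y => h (x, y)).
Proof. by move=> bh; apply: bmfun_comp bh; exact: pair1_measurable. Qed.

Lemma bmfun_section2 (h : X * Y -> R) y : bmfun h -> bmfun (fun x => h (x, y)).
Proof. by move=> bh; apply: bmfun_comp bh; exact: pair2_measurable. Qed.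

Lemma fubini_F_mean (h : X * Y -> R) : bmfun h ->
  fubini_F nu (EFin \o h) = EFin \o (fun x => mean nu (fun y => h (x, y))).
Proof.
move=> bh; apply/funext => x /=; rewrite /fubini_F /mean /Rintegral fineK//.
by apply: integrable_fin_num => //; exact/bmfun_integrable/bmfun_section.
Qed.

Lemma fubini_G_mean (h : X * Y -> R) : bmfun h ->
  fubini_G mu (EFin \o h) = EFin \o (fun y => mean mu (fun x => h (x, y))).
Proof.
move=> bh; apply/funext => x /=; rewrite /fubini_G /mean /Rintegral fineK//.
by apply: integrable_fin_num => //; exact/bmfun_integrable/bmfun_section2.
Qed.

Lemma mean_prod (h : X * Y -> R) : bmfun h ->
  mean (mu \x nu)%E h = mean mu (fun x => mean nu (fun y => h (x, y))).
Proof.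
move=> bh; rewrite /mean {1}/Rintegral -integral12_prod_meas1; last first.
  exact: (bmfun_integrable _ bh).
by rewrite fubini_F_mean.
Qed.

Lemma mean_swap (h : X * Y -> R) : bmfun h ->
  mean mu (fun x => mean nu (fun y => h (x, y))) =
  mean nu (fun y => mean mu (fun x => h (x, y))).
Proof.
move=> bh; rewrite -mean_prod// /mean {1}/Rintegral -integral21_prod_meas1.
  by rewrite fubini_G_mean.
exact: (bmfun_integrable _ bh).
Qed.

End Fubini.

Lemma bmfun_mean d1 d2 (X : measurableType d1) (Y : measurableType d2)
    (nu : probability Y R) (h : X * Y -> R) : bmfun h ->
  bmfun (fun x => mean nu (fun y => h (x, y))).
Proof.
move=> bh; split; last first.
  have [_ [M hM]] := bh; exists M => x; apply: norm_mean_le => //.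
  exact: bmfun_section.
(* Measurability of the partial integral is available in the presence of a measure on [X]; a Dirac
   mass serves, so the case of empty [X] is settled apart. *)
have [x0|noX] := pselect (exists x : X, True); last first.
  by move=> _ Y0 _; rewrite (_ : _ `&` _ = set0)//; apply/seteqP; split => // x;
     exfalso; apply: noX; exists x.
have [x _] := x0.
apply/measurable_EFinP; rewrite -/(EFin \o _) -fubini_F_mean//.
exact: (@measurable_fubini_F _ _ _ _ _ (\d_x : probability X R) nu _
  (bmfun_integrable _ bh)).
Qed.

Lemma mean_comp_invariant d (X : measurableType d) (mu : probability X R)
    (T : X -> X) (f : X -> R) : measurable_fun setT T ->
  (forall A, measurable A -> mu (T @^-1` A) = mu A) -> bmfun f ->
  mean mu (fun x => f (T x)) = mean mu f.
Proof.
move=> mT muT bf; rewrite /mean /Rintegral; congr fine.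
transitivity (\int[pushforward mu T]_x (f x)%:E)%E.
  rewrite integral_pushforward//; first by apply/measurable_EFinP; case: bf.
  exact/bmfun_integrable/(bmfun_comp mT bf).
by apply: eq_measure_integral => A mA _; exact: muT.
Qed.

End BoundedMeasurable.

(** * Bounded kernels *)

Section Rectangles.
Context {R : realType} d1 d2 (X : measurableType d1) (Y : measurableType d2).
Context (mu : probability X R) (nu : probability Y R).

(** The sets over which [h] integrates to zero form a Dynkin system. It contains the rectangles, a
    generating pi-system, so [h] vanishes almost everywhere. *)
Lemma mean_sqr_rectangles (h : X * Y -> R) : bmfun h ->
  (forall A B, measurable A -> measurable B ->
    mean mu (fun x => mean nu (fun y => \1_A x * (\1_B y * h (x, y)))) = 0) ->
  mean (mu \x nu)%E (fun z => h z ^+ 2) = 0.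
Proof.
move=> bh hAB; have ih := bmfun_integrable (mu \x nu)%E bh.
have mh : measurable_fun setT (EFin \o h) by apply/measurable_EFinP; case: bh.
have rect A B : measurable A -> measurable B ->
    (\int[mu \x nu]_(z in A `*` B) (h z)%:E = 0)%E.
  move=> mA mB; rewrite integral_mkcond.
  have bg : bmfun (fun z : X * Y => \1_A z.1 * (\1_B z.2 * h z)).
    apply: bmfunM; first exact: (bmfun_comp measurable_fst (bmfun_indic mA)).
    by apply: bmfunM => //; exact: (bmfun_comp measurable_snd (bmfun_indic mB)).
  transitivity (\int[mu \x nu]_z (\1_A z.1 * (\1_B z.2 * h z))%:E)%E.
    apply: eq_integral => z _; rewrite patchE !indicE in_setX.
    by case: (_ \in _) => /=; case: (_ \in _) => //=; rewrite ?mul0r ?mul1r ?mul0r.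
  rewrite -[LHS]fineK; last first.
    by apply: integrable_fin_num => //; exact: (bmfun_integrable _ bg).
  by rewrite -[X in X%:E]/(mean _ _) mean_prod// hAB.
have all0 : forall S : set (X * Y), measurable S ->
    (\int[mu \x nu]_(z in S) (h z)%:E = 0)%E.
  move=> S mS; have := mS; rewrite measurable_prod_measurableType => mS'.
  pattern S; move: S {mS} mS'; apply: dynkin_induction.
  - exact: measurable_prod_measurableType.
  - move=> _ _ [A mA [B mB <-]] [A' mA' [B' mB' <-]].
    exists (A `&` A'); first exact: measurableI.
    by exists (B `&` B'); [exact: measurableI | rewrite setXI].
  - by rewrite -setXTT rect.
  - by move=> _ [A mA [B mB <-]]; rewrite rect.
  - move=> S mS S0.
    have : (\int[mu \x nu]_(z in S `|` ~` S) (h z)%:E = 0)%E.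
      by rewrite setUv -setXTT rect.
    rewrite integral_setU//; last 3 first.
      exact: measurableC.
      by rewrite setUv.
      by rewrite disj_set2E setICr.
    by rewrite S0 add0e.
  - move=> F mF tF F0; rewrite (integral_bigcup tF mF).
      by under eq_eseriesr do rewrite F0; rewrite eseries0.
    by apply: integrableS ih => //; exact: bigcup_measurable.
have ae0 : ae_eq (mu \x nu)%E setT (EFin \o h) (cst 0%E).
  by apply: integral_ae_eq => // E _ mE; rewrite integral0 all0.
rewrite -[RHS](mean_cst (mu \x nu)%E 0); apply: eq_mean_negligible.
- exact: bmfunM.
- exact: bmfun_cst.
- apply: negligibleS ae0 => z /=; rewrite sqrf_eq0 => /eqP hz.
  by apply/not_implyP; split => // -[].
Qed.

End Rectangles.

Section Kernels.
Context {R : realType} d (X : measurableType d) (Q : probability X R).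
Implicit Types k l m : X -> X -> R.

Definition bkernel k : Prop := bmfun (fun z : X * X => k z.1 z.2).

(** The kernel of the composition of the two integral operators. *)
Definition kcomp k l x y : R := mean Q (fun z => k x z * l z y).

(** The Hilbert-Schmidt inner product. *)
Definition kdot k l : R := mean (Q \x Q)%E (fun z => k z.1 z.2 * l z.1 z.2).

Lemma bkernel_pull d' (Y : measurableType d') k (f g : Y -> X) : bkernel k ->
  measurable_fun setT f -> measurable_fun setT g ->
  bmfun (fun y => k (f y) (g y)).
Proof.
by move=> bk mf mg; apply: (bmfun_comp _ bk (h := fun y => (f y, g y)));
   exact: measurable_fun_pair.
Qed.

Lemma bkernel_row k x : bkernel k -> bmfun (k x).
Proof. by move=> bk; apply: (bkernel_pull bk) => //; exact: measurable_cst. Qed.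

Lemma bkernel_col k y : bkernel k -> bmfun (k ^~ y).
Proof. by move=> bk; apply: (bkernel_pull bk) => //; exact: measurable_cst. Qed.

Lemma bkernel_diag k : bkernel k -> bmfun (fun x => k x x).
Proof. by move=> bk; exact: (bkernel_pull bk). Qed.

Lemma bkernel_tr k : bkernel k -> bkernel (fun x y => k y x).
Proof. by move=> bk; exact: (bkernel_pull bk measurable_snd measurable_fst). Qed.

Lemma bkernelM k l : bkernel k -> bkernel l -> bkernel (fun x y => k x y * l x y).
Proof. exact: bmfunM. Qed.

Lemma bkernelZ c k : bkernel k -> bkernel (fun x y => c * k x y).
Proof. exact: bmfunZ. Qed.

Lemma bkernelB k l : bkernel k -> bkernel l -> bkernel (fun x y => k x y - l x y).
Proof. exact: bmfunB. Qed.

Lemma bkernel_left (f : X -> R) : bmfun f -> bkernel (fun x _ => f x).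
Proof. exact: bmfun_comp. Qed.

Lemma bkernel_right (f : X -> R) : bmfun f -> bkernel (fun _ y => f y).
Proof. exact: bmfun_comp. Qed.

Lemma bkernel_kcomp k l : bkernel k -> bkernel l -> bkernel (kcomp k l).
Proof.
move=> bk bl.
apply: (@bmfun_mean _ _ _ (X * X)%type X Q
  (fun w => k w.1.1 w.2 * l w.2 w.1.2)).
have m11 : measurable_fun setT (fun w : X * X * X => w.1.1).
  exact: (measurableT_comp measurable_fst measurable_fst).
have m12 : measurable_fun setT (fun w : X * X * X => w.1.2).
  exact: (measurableT_comp measurable_snd measurable_fst).
by apply: bmfunM; exact: bkernel_pull.
Qed.

Lemma mean_kswap k : bkernel k ->
  mean Q (fun x => mean Q (fun y => k x y)) =
  mean Q (fun y => mean Q (fun x => k x y)).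
Proof. exact: (@mean_swap _ _ _ _ _ Q Q (fun z => k z.1 z.2)). Qed.

Lemma bmfun_kmean k : bkernel k -> bmfun (fun x => mean Q (k x)).
Proof. exact: (@bmfun_mean _ _ _ _ _ Q (fun z => k z.1 z.2)). Qed.

Lemma kdotE k l : bkernel k -> bkernel l ->
  kdot k l = mean Q (fun x => mean Q (fun y => k x y * l x y)).
Proof. by move=> bk bl; rewrite /kdot mean_prod//; exact: bkernelM. Qed.

Lemma kdot_CauchySchwarz k l : bkernel k -> bkernel l ->
  kdot k l ^+ 2 <= kdot k k * kdot l l.
Proof. by move=> bk bl; have := mean_CauchySchwarz (Q \x Q)%E bk bl. Qed.

Lemma kdot_ge0 k : 0 <= kdot k k.
Proof. by apply: mean_ge0 => z; rewrite -expr2 sqr_ge0. Qed.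

(** Fubini. The identity holds at every point, and so do all later kernel identities; no
    almost-everywhere class is ever formed. *)
Lemma kcompA k l m : bkernel k -> bkernel l -> bkernel m ->
  kcomp k (kcomp l m) =2 kcomp (kcomp k l) m.
Proof.
move=> bk bl bm x y; rewrite /kcomp.
transitivity (mean Q (fun z => mean Q (fun w => k x z * l z w * m w y))).
  apply: eq_mean => z; rewrite -meanZ; last first.
    by apply: bmfunM; [exact: bkernel_row | exact: bkernel_col].
  by apply: eq_mean => w; rewrite mulrA.
rewrite (@mean_kswap (fun z w => k x z * l z w * m w y)).
  apply: eq_mean => w; rewrite -meanZr//.
  by apply: bmfunM; [exact: bkernel_row | exact: bkernel_col].
by apply: bkernelM; [apply: bkernelM => //|];
   [apply/bkernel_left/bkernel_row | apply/bkernel_right/bkernel_col].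
Qed.

(** Submultiplicativity of the Hilbert-Schmidt norm: Cauchy-Schwarz in the middle variable leaves a
    product of a function of [x] and a function of [y]. *)
Lemma kdot_kcomp_le k l : bkernel k -> bkernel l ->
  kdot (kcomp k l) (kcomp k l) <= kdot k k * kdot l l.
Proof.
move=> bk bl; have bkl := bkernel_kcomp bk bl.
have bkk : bmfun (fun x => mean Q (fun z => k x z ^+ 2)).
  by apply: bmfun_kmean; exact: bkernelM.
have bll : bmfun (fun y => mean Q (fun z => l z y ^+ 2)).
  by apply: (@bmfun_kmean (fun y z => l z y ^+ 2)); apply: bkernelM;
     exact: bkernel_tr.
rewrite kdotE// [kdot k k]kdotE// [kdot l l]kdotE// [X in _ * X]mean_kswap; last first.
  exact: bkernelM.
apply: (@le_trans _ _ (mean Q (fun x => mean Q (fun y =>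
    mean Q (fun z => k x z ^+ 2) * mean Q (fun z => l z y ^+ 2))))).
  apply: le_mean.
  - by apply: bmfun_kmean; exact: bkernelM.
  - apply: bmfun_kmean; apply: bkernelM.
    + exact: bkernel_left.
    + exact: bkernel_right.
  move=> x; apply: le_mean.
  - by apply: bmfunM; exact: bkernel_row.
  - by apply: bmfunM => //; exact: bmfun_cst.
  - by move=> y; rewrite -expr2; apply: mean_CauchySchwarz;
       [exact: bkernel_row | exact: bkernel_col].
under eq_mean do rewrite meanZ//.
by rewrite meanZr.
Qed.

(* If [k k^T = 0] then [||k^T 1_A||^2 = <k k^T 1_A, 1_A> = 0] for every [A], so
   [k] integrates to zero on rectangles. *)
Lemma kdot_eq0_of_gram k : bkernel k ->
  let s := kcomp k (fun x y => k y x) in kdot s s = 0 -> kdot k k = 0.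
Proof.
move=> bk s s0; have bkt := bkernel_tr bk.
have bs : bkernel s by exact: bkernel_kcomp.
apply: (@mean_sqr_rectangles _ _ _ _ _ Q Q (fun z => k z.1 z.2)) => //=.
move=> A B mA mB.
have bA : bmfun (\1_A : X -> R) by exact: bmfun_indic.
have bB : bmfun (\1_B : X -> R) by exact: bmfun_indic.
pose w z := mean Q (fun x => \1_A x * k x z).
have bAk : bkernel (fun x z => \1_A x * k x z).
  by apply: bkernelM => //; exact: bkernel_left.
have bw : bmfun w by apply: (@bmfun_kmean (fun z x => \1_A x * k x z));
  exact: (bkernel_tr bAk).
have w0 : mean Q (fun z => w z ^+ 2) = 0.
  (* Written as a [kdot] with a rank-one kernel, the quadratic form is killed by Cauchy-Schwarz, the
     norm of [s] being zero. *)
  transitivity (kdot (fun x y => \1_A x * \1_A y) s); last first.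
    apply/eqP; rewrite -sqrf_eq0; apply/eqP/le_anti; rewrite sqr_ge0 andbT.
    have := kdot_CauchySchwarz (bkernelM (bkernel_left bA) (bkernel_right bA)) bs.
    by rewrite s0 mulr0.
  rewrite kdotE//; last first.
    by apply: bkernelM; [exact: bkernel_left | exact: bkernel_right].
  transitivity (mean Q (fun z => mean Q (fun x => \1_A x * k x z * w z))).
    by apply: eq_mean => z; rewrite meanZr//; exact: (bkernel_col _ bAk).
  rewrite -mean_kswap; last by apply: bkernelM => //; exact: bkernel_right.
  apply: eq_mean => x.
  transitivity (mean Q (fun z => mean Q (fun y =>
      \1_A x * k x z * (\1_A y * k y z)))).
    by apply: eq_mean => z; rewrite meanZ//; exact: (bkernel_col _ bAk).
  rewrite (@mean_kswap (fun z y => \1_A x * k x z * (\1_A y * k y z))).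
    apply: eq_mean => y; rewrite /s /kcomp -meanZ.
      by apply: eq_mean => z; ring.
    by apply: bmfunM; [exact: bkernel_row|exact: (@bkernel_col (fun x y => k y x))].
  apply: bkernelM; last exact: (bkernel_tr bAk).
  by apply: bkernel_left; exact: (bkernel_row _ bAk).
rewrite (@mean_kswap (fun x y => \1_A x * (\1_B y * k x y))); last first.
  apply: bkernelM; first exact: bkernel_left.
  by apply: bkernelM => //; exact: bkernel_right.
transitivity (mean Q (fun z => \1_B z * w z)).
  apply: eq_mean => z; rewrite /w -meanZ; last exact: (bkernel_col _ bAk).
  by apply: eq_mean => x; ring.
apply/eqP; rewrite -sqrf_eq0; apply/eqP/le_anti; rewrite sqr_ge0 andbT.
by have := mean_CauchySchwarz Q bB bw; rewrite w0 mulr0.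
Qed.

End Kernels.

(** * The top spectral projection of a symmetric kernel *)

Section KernelPowers.
Context {R : realType} d (X : measurableType d) (Q : probability X R).
Variables (K : X -> X -> R) (bK : bkernel K) (symK : forall x y, K x y = K y x).
Local Notation kcomp := (kcomp Q).
Local Notation kdot := (kdot Q).

(* [kpow n] is the kernel of the operator power [K^(n+1)]. *)
Fixpoint kpow n : X -> X -> R := if n is n'.+1 then kcomp K (kpow n') else K.

Lemma bkernel_kpow n : bkernel (kpow n).
Proof. by elim: n => //= n; exact: bkernel_kcomp. Qed.

(** The successor comes from the index shift: the exponents [m+1] and [n+1] add up to
    [(m+n+1)+1]. *)
Lemma kcomp_kpow m n : kcomp (kpow m) (kpow n) =2 kpow (m + n).+1.
Proof.
elim: m => [//|m IH] x y.
rewrite /= -kcompA//; try exact: bkernel_kpow.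
by apply: eq_mean => z; rewrite IH.
Qed.

Lemma kpow_sym n x y : kpow n x y = kpow n y x.
Proof.
elim: n x y => [//|n IH] x y.
(* The extra factor [K] is split off on the right on one side and on the left on the other. *)
rewrite [RHS]/= -(addn0 n) -[LHS](kcomp_kpow n 0) addn0.
by apply: eq_mean => z; rewrite mulrC IH /= symK.
Qed.

Definition ktrace n : R := mean Q (fun x => kpow n x x).

Lemma kdot_kpow m n : kdot (kpow m) (kpow n) = ktrace (m + n).+1.
Proof.
rewrite kdotE; try exact: bkernel_kpow.
apply: eq_mean => x; rewrite -kcomp_kpow; apply: eq_mean => z.
by rewrite (kpow_sym n x z).
Qed.

(* [kmom n] is the trace of [K^(2n+2)], that is the sum of the powers [n+1] of
   the squared eigenvalues of [K]. *)
Definition kmom n : R := kdot (kpow n) (kpow n).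

Lemma kmomE n : kmom n = ktrace n.*2.+1.
Proof. by rewrite /kmom kdot_kpow addnn. Qed.

Lemma kmom_logconvex n : kmom n.+1 ^+ 2 <= kmom n * kmom n.+2.
Proof.
(* Both are the trace of [K^(2n+4)]. *)
have -> : kmom n.+1 = kdot (kpow n) (kpow n.+2).
  by rewrite kmomE kdot_kpow !addnS addnn doubleS.
by apply: kdot_CauchySchwarz; exact: bkernel_kpow.
Qed.

Lemma kmom_submul m n : kmom (m + n).+1 <= kmom m * kmom n.
Proof.
have -> : kmom (m + n).+1 = kdot (kcomp (kpow m) (kpow n)) (kcomp (kpow m) (kpow n)).
  by apply: eq_mean => z; rewrite !kcomp_kpow.
by apply: kdot_kcomp_le; exact: bkernel_kpow.
Qed.

Hypothesis K_neq0 : kdot K K != 0.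

(** By symmetry [K^2 = K K^T], so [kmom 1] is nonzero by [kdot_eq0_of_gram]; log-convexity
    propagates positivity from two consecutive moments to the next. *)
Lemma kmom_gt0 n : 0 < kmom n.
Proof.
have m0 : 0 < kmom 0 by rewrite lt_neqAle eq_sym K_neq0 kdot_ge0.
have m1 : 0 < kmom 1.
  rewrite lt_neqAle kdot_ge0 andbT; apply: contra K_neq0 => /eqP m10.
  apply/eqP/(kdot_eq0_of_gram bK); rewrite [RHS]m10.
  by congr kdot; apply/funext => x; apply/funext => y; apply: eq_mean => z;
     rewrite [in LHS](symK y z).
suff : 0 < kmom n /\ 0 < kmom n.+1 by case.
elim: n => [//|n [IH1 IH2]]; split => //.
have := kmom_logconvex n; rewrite leNgt => /negP; apply: contra_notT.
rewrite -leNgt => n2; rewrite (@le_lt_trans _ _ 0) ?exprn_gt0//.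
by rewrite mulr_ge0_le0// ltW.
Qed.

Let ratio n := kmom n.+1 / kmom n.

Let ratio_gt0 n : 0 < ratio n.
Proof. by rewrite divr_gt0 ?kmom_gt0. Qed.

Let ratio_nd : nondecreasing_seq ratio.
Proof.
apply/nondecreasing_seqP => n; rewrite /ratio ler_pdivrMr ?kmom_gt0//.
rewrite mulrAC ler_pdivlMr ?kmom_gt0// -expr2 mulrC.
exact: kmom_logconvex.
Qed.

Let ratio_cvg : cvgn ratio.
Proof.
apply: nondecreasing_is_cvgn => //; exists (kmom 0) => _ [n _ <-].
by rewrite ler_pdivrMr ?kmom_gt0// (kmom_submul 0).
Qed.

(** Log-convexity makes the ratios of consecutive moments increase and submultiplicativity bounds
    them by [kmom 0]. The limit is the largest eigenvalue of [K^2], reached without a spectral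
    theorem. *)
Definition ktop : R := limn ratio.

Lemma ktop_gt0 : 0 < ktop.
Proof. by rewrite (lt_le_trans (ratio_gt0 0))// nondecreasing_cvgn_le. Qed.

(** The trace of [(K^2 / ktop)^(n+1)]. *)
Definition nmom n : R := kmom n / ktop ^+ n.+1.

Lemma nmom_gt0 n : 0 < nmom n.
Proof. by rewrite divr_gt0 ?kmom_gt0// exprn_gt0// ktop_gt0. Qed.

Lemma nmomS n : nmom n.+1 = nmom n * (ratio n / ktop).
Proof.
rewrite /nmom /ratio [in LHS]exprS; field.
by rewrite !gt_eqF ?kmom_gt0 ?exprn_gt0 ?ktop_gt0.
Qed.

Lemma nmom_ni : nonincreasing_seq nmom.
Proof.
apply/nonincreasing_seqP => n; rewrite nmomS ler_piMr ?(ltW (nmom_gt0 _))//.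
by rewrite ler_pdivrMr ?ktop_gt0// mul1r nondecreasing_cvgn_le.
Qed.

Lemma nmom_cvg : cvgn nmom.
Proof.
apply: nonincreasing_is_cvgn; first exact: nmom_ni.
by exists 0 => _ [n _ <-]; rewrite ltW ?nmom_gt0.
Qed.

(** The limit of [nmom] is not yet known to be nonzero, so the quotient is treated as a product of
    [k] factors [ratio / ktop], each tending to 1. *)
Lemma nmom_ratio_cvg k : (fun n => nmom (n + k) / nmom n) @ \oo --> (1 : R).
Proof.
elim: k => [|k IH].
  rewrite (_ : (fun n => _) = (fun=> 1)); first exact: cvg_cst.
  by apply/funext => n; rewrite addn0 divff// gt_eqF ?nmom_gt0.
rewrite (_ : (fun n => _) = (fun n => (ratio (n + k) / ktop) * (nmom (n + k) / nmom n))).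
  rewrite -[X in _ --> X]mulr1; apply: cvgM => //.
  rewrite -(divff (lt0r_neq0 ktop_gt0)); apply: cvgMl.
  by rewrite (cvg_shiftn k ratio).
by apply/funext => n; rewrite addnS nmomS mulrAC mulrC.
Qed.

(* The top eigenvalue is attained: its multiplicity, the limit of [nmom], is at
   least one. *)
Lemma nmom_ge1 m : 1 <= nmom m.
Proof.
(* Submultiplicativity bounds [nmom (n + m.+1) / nmom n] by [nmom m], and the left side tends to
   1. *)
have := @nmom_ratio_cvg m.+1; move/cvgr_to_le; apply; near=> n.
rewrite ler_pdivrMr ?nmom_gt0// /nmom mulf_div -exprD.
rewrite addnS addSn addnS addnC.
by rewrite ler_pM2r ?invr_gt0 ?exprn_gt0 ?ktop_gt0// kmom_submul.
Unshelve. all: by end_near. Qed.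

End KernelPowers.

Section KernelProjection.
Context {R : realType} d (X : measurableType d) (Q : probability X R).
Variables (K : X -> X -> R) (bK : bkernel K) (symK : forall x y, K x y = K y x).
Hypothesis K_neq0 : kdot Q K K != 0.
Local Notation kcomp := (kcomp Q).
Local Notation kdot := (kdot Q).
Local Notation kpow := (kpow Q K).
Local Notation nmom := (nmom Q K).
Local Notation ktop := (ktop Q K).

Let ktop_gt0 : 0 < ktop := ktop_gt0 bK symK K_neq0.
Let nmom_ge1 := nmom_ge1 bK symK K_neq0.
Let bkernel_kpow := bkernel_kpow Q bK.

(** Two applications of Cauchy-Schwarz against rows and columns of the bounded kernel [K]. This
    upgrades a bound in [L^2] to a uniform one. *)
Lemma kcomp_sandwich (D : X -> X -> R) C x y : bkernel D ->
  (forall x y, `|K x y| <= C) ->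
  kcomp K (kcomp D K) x y ^+ 2 <= C ^+ 4 * kdot D D.
Proof.
move=> bD KC; have C0 : 0 <= C by rewrite (le_trans _ (KC x x)).
have K2 u v : K u v ^+ 2 <= C ^+ 2.
  by rewrite -[leLHS]real_normK ?num_real// lerXn2r ?nnegrE.
have KK2 u : mean Q (fun z => K u z ^+ 2) <= C ^+ 2.
  rewrite -(mean_cst Q (C ^+ 2)); apply: le_mean => //.
  - by apply: bmfunM; exact: bkernel_row.
  - exact: bmfun_cst.
have bDK := bkernel_kcomp Q bD bK.
have DK z : kcomp D K z y ^+ 2 <= C ^+ 2 * mean Q (fun w => D z w ^+ 2).
  apply: le_trans (mean_CauchySchwarz Q (bkernel_row z bD) (bkernel_col y bK)) _.
  rewrite mulrC ler_wpM2r//; first by apply: mean_ge0 => w; exact: sqr_ge0.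
  by under eq_mean do rewrite symK; exact: KK2.
apply: le_trans (mean_CauchySchwarz Q (bkernel_row x bK) (bkernel_col y bDK)) _.
rewrite (_ : C ^+ 4 = C ^+ 2 * C ^+ 2); last by rewrite -exprD.
rewrite -mulrA.
apply: ler_pM => //; try by apply: mean_ge0 => w; exact: sqr_ge0.
have bDD : bmfun (fun z => mean Q (fun w => D z w ^+ 2)).
  by apply: bmfun_kmean; exact: bkernelM.
rewrite kdotE// -meanZ//; apply: le_mean => //.
- by apply: bmfunM; exact: bkernel_col.
- exact: bmfunZ.
Qed.

(** The kernel of [(K^2 / ktop)^(n+1)]: the index [2n+1] of [kpow] stands for the exponent
    [2n+2]. *)
Let npow n x y := kpow n.*2.+1 x y / ktop ^+ n.+1.

Let bnpow n : bkernel (npow n).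
Proof.
have := bkernelZ (ktop ^+ n.+1)^-1 (bkernel_kpow n.*2.+1); congr bkernel.
by apply/funext => x; apply/funext => y; rewrite mulrC.
Qed.

Let kdot_npow n m : kdot (npow n) (npow m) = nmom (n + m).+1.
Proof.
rewrite /nmom kmomE//.
have -> : ((n + m).+1.*2.+1 = (n.*2.+1 + m.*2.+1).+1)%N.
  by rewrite doubleS doubleD addSn addnS.
rewrite -kdot_kpow// /kdot -meanZr; last exact: bkernelM.
apply: eq_mean => z; rewrite /npow mulf_div -exprD.
by rewrite addSn addnS.
Qed.

Let kdot_npowB n m :
  kdot (fun x y => npow n x y - npow m x y) (fun x y => npow n x y - npow m x y)
  = nmom (n + n).+1 - 2 * nmom (n + m).+1 + nmom (m + m).+1.
Proof.
rewrite -!kdot_npow /kdot -meanZ; last exact: bkernelM.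
rewrite -meanB; [|exact: bkernelM|exact/bmfunZ/bkernelM].
rewrite -meanD; [|by apply: bmfunB; [exact: bkernelM|exact/bmfunZ/bkernelM]|
                 exact: bkernelM].
by apply: eq_mean => z; ring.
Qed.

Let npowS n x y : npow n.+1 x y = ktop^-1 * kcomp K (kcomp (npow n) K) x y.
Proof.
have -> : kcomp K (kcomp (npow n) K) x y =
    kcomp K (kcomp (kpow n.*2.+1) K) x y / ktop ^+ n.+1.
  rewrite -meanZr; last first.
    apply: bmfunM; first exact: bkernel_row.
    by apply: bkernel_col; exact: bkernel_kcomp.
  apply: eq_mean => z; rewrite -mulrA; congr (_ * _).
  rewrite -meanZr; last first.
    by apply: bmfunM; [exact: bkernel_row | exact: bkernel_col].
  by apply: eq_mean => w; rewrite mulrAC.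
rewrite /npow (exprS _ n.+1) invfM mulrCA; congr (_ * _).
congr (_ / _); rewrite doubleS /=.
by apply: eq_mean => z; rewrite (kcomp_kpow Q bK n.*2.+1 0) addn0.
Qed.

(** The squared [L^2] distance of two iterates is a combination of values of [nmom] with
    coefficients 1, -2, 1, small because [nmom] converges; one more step of [npowS] makes the
    estimate uniform. *)
Let npow_cauchy (e : R) : 0 < e -> exists N, forall n m x y,
  (N <= n)%N -> (N <= m)%N -> `|npow n x y - npow m x y| <= e.
Proof.
move=> e0; have [_ [C KC]] := bK.
pose c := Num.max 1 C.
have c1 : 1 <= c by rewrite le_max lexx.
have {}KC x y : `|K x y| <= c by rewrite (le_trans (KC (x, y)))// le_max lexx orbT.
(* Moments within [e'] of their limit put the squared distance below [4 * e']; the sandwich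
   multiplies it by [c ^+ 4] and [npowS] divides the difference by [ktop]. *)
pose e' := (e * ktop) ^+ 2 / (4 * c ^+ 4).
have c4 : 0 < c ^+ 4 by rewrite exprn_gt0// (lt_le_trans ltr01).
have e'0 : 0 < e' 
  by apply: divr_gt0; [apply: exprn_gt0; exact: mulr_gt0 | exact: mulr_gt0].
have /cvgrPdist_le/(_ _ e'0)[N _ HN] := nmom_cvg bK symK K_neq0.
exists N.+1 => -[//|n] [//|m] x y; rewrite !ltnS => Nn Nm.
rewrite !npowS -mulrBr.
set D := fun x y => npow n x y - npow m x y.
have bD : bkernel D by exact: bkernelB.
have -> : kcomp K (kcomp (npow n) K) x y - kcomp K (kcomp (npow m) K) x y =
    kcomp K (kcomp D K) x y.
  rewrite -meanB; try (apply: bmfunM; [exact: bkernel_row|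
    by apply: bkernel_col; exact: bkernel_kcomp]).
  apply: eq_mean => z; rewrite -mulrBr -meanB; try (apply: bmfunM;
    [exact: bkernel_row| exact: bkernel_col]).
  by congr (_ * _); apply: eq_mean => w; rewrite -mulrBl.
have := kcomp_sandwich x y bD KC; rewrite /D kdot_npowB.
set l := limn nmom in HN *.
have h a b : (N <= a)%N -> `|l - nmom (a + b).+1| <= e'.
  by move=> Na; apply: HN => /=; rewrite -addnS (leq_trans Na)// leq_addr.
move=> hle.
have := h _ m Nm; rewrite ler_norml => /andP[h1 h2].
have := h _ m Nn; rewrite ler_norml => /andP[h3 h4].
have := h _ n Nn; rewrite ler_norml => /andP[h5 h6].
rewrite normrM gtr0_norm ?invr_gt0// mulrC ler_pdivrMr//.
rewrite -(@ler_pXn2r _ 2) ?nnegrE ?mulr_ge0 ?(ltW e0) ?(ltW ktop_gt0)//.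
rewrite real_normK ?num_real//; apply: le_trans hle _.
have -> : (e * ktop) ^+ 2 = c ^+ 4 * (4 * e').
  by rewrite /e'; field; rewrite gt_eqF// (lt_le_trans ltr01).
rewrite ler_pM2l//; lra.
Qed.

Let kproj x y := limn (fun n => npow n x y).

Let npow_cvg x y : cvgn (fun n => npow n x y).
Proof.
apply/cauchy_cvgP/cauchy_ballP => e e0.
have /npow_cauchy[N HN] : 0 < e / 2 by rewrite divr_gt0.
near_simpl.
exists ([set n | (N <= n)%N], [set n | (N <= n)%N]) => /=.
  by split; exists N.
move=> [n m] /= [Nn Nm]; rewrite /ball /=.
by rewrite (le_lt_trans (HN _ _ _ _ Nn Nm))// ltr_pdivrMr// ltr_pMr// ltr1n.
Qed.

Let kproj_unif (e : R) : 0 < e -> exists N, forall n x y,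
  (N <= n)%N -> `|npow n x y - kproj x y| <= e.
Proof.
move=> e0; have [N HN] := npow_cauchy e0; exists N => n x y Nn.
have : (fun m => `|npow n x y - npow m x y|) @ \oo --> `|npow n x y - kproj x y|.
  by apply: cvg_norm; apply: cvgB; [exact: cvg_cst | exact: npow_cvg].
move/cvgr_to_le; apply; near=> m; apply: HN => //.
by near: m; exists N.
Unshelve. all: by end_near. Qed.

Let bkproj : bkernel kproj.
Proof.
split.
  apply: (@measurable_fun_cvg _ _ _ _ (fun n z => npow n z.1 z.2)).
    by move=> n; case: (bnpow n).
  by move=> z _; exact: npow_cvg.
have [N HN] := kproj_unif ltr01; have [_ [M HM]] := bnpow N.
exists (M + 1) => z; have := HN N z.1 z.2 (leqnn _); have := HM z.
by rewrite !ler_norml => /andP[? ?] /andP[? ?]; apply/andP; split; lra.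
Qed.

Let le_eps (a b : R) : (forall e, 0 < e -> e <= 1 -> a <= b * e) -> a <= 0.
Proof.
move=> ab; rewrite leNgt; apply/negP => a0.
have b0 : 0 < b by have := ab 1 ltr01 (lexx _); rewrite mulr1; exact: lt_le_trans.
pose e := Num.min 1 (a / (2 * b)).
have e0 : 0 < e by rewrite lt_min ltr01 divr_gt0// mulr_gt0.
have := ab e e0; rewrite ge_min lexx => /(_ isT); rewrite leNgt => /negP; apply.
apply: (@le_lt_trans _ _ (a / 2)); last by rewrite ltr_pdivrMr// ltr_pMr// ltr1n.
apply: (@le_trans _ _ (b * (a / (2 * b)))).
  by rewrite ler_wpM2l ?(ltW b0)// ge_min lexx orbT.
by rewrite (_ : b * _ = a / 2)//; field; rewrite gt_eqF.
Qed.

(** The square of [npow N] is [npow (N + N).+1], and both are uniformly close to [kproj] for large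
    [N]. *)
Let kproj_idem : kcomp kproj kproj =2 kproj.
Proof.
move=> x y; apply/eqP; rewrite -subr_eq0 -normr_le0.
have [_ [B HB]] := bkproj.
have {}HB u v : `|kproj u v| <= B by exact: (HB (u, v)).
apply: (@le_eps _ (2 * B + 2)) => e e0 e1.
have [N HN] := kproj_unif e0.
have LL : kcomp (npow N) (npow N) x y = npow (N + N).+1 x y.
  rewrite /npow.
  have -> : ((N + N).+1.*2.+1 = (N.*2.+1 + N.*2.+1).+1)%N by lia.
  rewrite -[in RHS](kcomp_kpow Q bK).
  rewrite -meanZr; last by apply: bmfunM; [exact: bkernel_row|exact: bkernel_col].
  by apply: eq_mean => z; rewrite mulf_div -exprD addSn addnS.
have h1 := HN (N + N).+1 x y (leq_trans (leq_addr _ _) (leqnSn _)).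
have h2 : `|kcomp kproj kproj x y - kcomp (npow N) (npow N) x y| <= (2 * B + 1) * e.
  rewrite -meanB; try by apply: bmfunM; [exact: bkernel_row|exact: bkernel_col].
  apply: norm_mean_le.
    by apply: bmfunB; apply: bmfunM; (exact: bkernel_row || exact: bkernel_col).
  move=> z; have := HN N x z (leqnn _); have := HN N z y (leqnn _).
  have := HB x z; have := HB z y.
  set p := kproj x z; set p' := kproj z y; set q := npow N x z; set q' := npow N z y.
  move=> Hp' Hp H' H.
  (* Only the bound on [kproj] is at hand, so [q] is rewritten as [(q - p) + p], of size at most
     [1 + B]. *)
  have -> : p * p' - q * q' = - (q - p) * p' - (q' - p') * ((q - p) + p) by ring.
  rewrite (le_trans (ler_normB _ _))// !normrM normrN.
  have -> : (2 * B + 1) * e = e * B + e * (1 + B) by ring.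
  rewrite lerD ?ler_pM//.
  by rewrite (le_trans (ler_normD _ _))// lerD// (le_trans H).
move: h2; rewrite LL; move: h1.
rewrite !ler_norml => /andP[h1 h2] /andP[h3 h4]; apply/andP; split; lra.
Qed.

(* The spectral projection of [K^2] onto its top eigenspace, obtained as the
   uniform limit of [K^(2n) / rho^n] with [rho] the top eigenvalue of [K^2]. *)
Lemma kernel_projection : exists P : X -> X -> R,
  [/\ bkernel P, forall x y, P x y = P y x, kcomp P P =2 P,
      0 < mean Q (fun x => P x x) &
      ((forall x, mean Q (K x) = 0) -> forall x, mean Q (P x) = 0) /\
      forall T : X -> X, measurable_fun setT T ->
        (forall A, measurable A -> Q (T @^-1` A) = Q A) ->
        (forall x y, K (T x) (T y) = K x y) ->
        forall x y, P (T x) (T y) = P x y].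
Proof.
exists kproj; split => //.
- move=> x y; rewrite /kproj; congr (lim (_ @ \oo)); apply/funext => n.
  by rewrite /npow kpow_sym.
(* The trace of [npow N] is [nmom N], at least 1, and a uniform error of one half cannot cancel
   it. *)
- have /kproj_unif[N HN] : 0 < 2^-1 :> R by rewrite invr_gt0.
  apply: (@lt_le_trans _ _ (mean Q (fun x => npow N x x - 2^-1))); last first.
    apply: le_mean.
    + apply: bmfunB; [exact: bkernel_diag | exact: bmfun_cst].
    + exact: bkernel_diag.
    + move=> x; have := HN N x x (leqnn _); rewrite ler_norml => /andP[_]; lra.
  rewrite meanB; [|exact: bkernel_diag|exact: bmfun_cst].
  rewrite mean_cst meanZr; last exact/bkernel_diag/bkernel_kpow.
  have := nmom_ge1 N; rewrite /nmom kmomE// /ktrace => h.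
  rewrite subr_gt0; apply: lt_le_trans h.
  by rewrite invf_lt1// ltr1n.
- split=> [K0 x|T mT QT KT x y].
    apply/eqP; rewrite -normr_le0; apply: (@le_eps _ 1) => e e0 _.
    have [N HN] := kproj_unif e0.
    have kpow0 n : forall x, mean Q (kpow n x) = 0.
      elim: n => [//|n IH] u /=.
      transitivity (mean Q (fun z => mean Q (fun y => K u z * kpow n z y))).
        rewrite [RHS]mean_kswap//; apply: bkernelM => //.
        by apply: bkernel_left; exact: bkernel_row.
      transitivity (mean Q (fun _ : X => 0)); last by rewrite mean_cst.
      apply: eq_mean => z; rewrite meanZ ?IH ?mulr0//.
      by apply: bkernel_row.
    have n0 : mean Q (npow N x) = 0.
      rewrite meanZr; last exact/bkernel_row.
      by rewrite kpow0 mul0r.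
    rewrite mul1r -normrN -[X in `|X|]add0r -n0 -meanB; try exact: bkernel_row.
    apply: norm_mean_le; first by apply: bmfunB; exact: bkernel_row.
    by move=> y; exact: HN.
  rewrite /kproj; congr (lim (_ @ \oo)); apply/funext => n.
  rewrite /npow; congr (_ / _); move: (n.*2.+1) => {}n.
  (* Invariance of [Q] lets the integration variable be replaced by its image under [T], so
     invariance passes from [K] to its powers. *)
  elim: n x y => [//|n IH] x y /=.
  rewrite /kcomp -(mean_comp_invariant mT QT).
    by apply: eq_mean => z; rewrite KT IH.
  by apply: bmfunM; [exact: bkernel_row|exact: bkernel_col].
Qed.

End KernelProjection.

(** * Finite rank and eigenfunctions of a projection kernel *)

Section ReproducingKernel.
Context {R : realType} d (X : measurableType d) (Q : probability X R).
Variables (P : X -> X -> R) (bP : bkernel P) (symP : forall x y, P x y = P y x).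
Hypothesis idemP : kcomp Q P P =2 P.

(** The range of the projection, with equality at every point: the value at [u] is the inner product
    with [P u], so point evaluations are bounded in [L^2]. *)
Definition reproduces (h : X -> R) : Prop :=
  bmfun h /\ forall u, mean Q (fun z => P u z * h z) = h u.

Lemma reproduces_row x : reproduces (P x).
Proof.
split=> [|u]; first exact: bkernel_row.
rewrite (symP x u) -idemP; apply: eq_mean => z; by rewrite (symP x z).
Qed.

Lemma reproducesZ c h : reproduces h -> reproduces (fun x => c * h x).
Proof.
move=> [bh rh]; split=> [|u]; first exact: bmfunZ.
rewrite -rh -meanZ; last by apply: bmfunM => //; exact: bkernel_row.
by apply: eq_mean => z; rewrite mulrCA.
Qed.

Lemma reproducesD g h : reproduces g -> reproduces h ->
  reproduces (fun x => g x + h x).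
Proof.
move=> [bg rg] [bh rh]; split=> [|u]; first exact: bmfunD.
rewrite -rg -rh -meanD; try by apply: bmfunM => //; exact: bkernel_row.
by apply: eq_mean => z; rewrite mulrDr.
Qed.

Lemma reproduces_sum n (F : 'I_n -> X -> R) : (forall i, reproduces (F i)) ->
  reproduces (fun x => \sum_(i < n) F i x).
Proof.
move=> rF; split=> [|u]; first by apply: bmfun_sum => i; case: (rF i).
transitivity (mean Q (fun z => \sum_(i < n) P u z * F i z)).
  by apply: eq_mean => z; rewrite mulr_sumr.
rewrite mean_sum; first by apply: eq_bigr => i _; case: (rF i).
by move=> i; apply: bmfunM; [exact: bkernel_row | case: (rF i)].
Qed.

Lemma reproduces_lincomb n (a : 'I_n -> R) (x : 'I_n -> X) :
  reproduces (fun u => \sum_(i < n) a i * P (x i) u).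
Proof.
by apply: reproduces_sum => i; apply: reproducesZ; exact: reproduces_row.
Qed.

Lemma reproduces_eq0 h : reproduces h -> mean Q (fun x => h x ^+ 2) = 0 ->
  forall u, h u = 0.
Proof.
move=> [bh rh] h0 u; apply/eqP; rewrite -sqrf_eq0 -rh.
apply/eqP/le_anti; rewrite sqr_ge0 andbT.
by have := mean_CauchySchwarz Q (bkernel_row u bP) bh; rewrite h0 mulr0.
Qed.

Definition gram n (x : 'I_n -> X) : 'M[R]_n := \matrix_(i, j) P (x i) (x j).

Definition krow n (x : 'I_n -> X) (u : X) : 'rV[R]_n := \row_j P u (x j).

Section Residual.
Variables (n : nat) (x : 'I_n -> X) (unitG : gram x \in unitmx) (u : X).

(** The coefficients of the orthogonal projection of [P u] onto the span of the [P (x i)]; [kres]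
    below is the remainder. *)
Definition kcoef : 'rV[R]_n := krow x u *m invmx (gram x).

Definition kres (y : X) : R := P u y - \sum_(i < n) kcoef ord0 i * P (x i) y.

Lemma reproduces_kres : reproduces kres.
Proof.
have -> : kres = (fun y => P u y + \sum_(i < n) - kcoef ord0 i * P (x i) y).
  by apply/funext => y; rewrite /kres -sumrN; congr (_ + _);
     apply: eq_bigr => i _; rewrite mulNr.
apply: reproducesD; first exact: reproduces_row.
exact: reproduces_lincomb.
Qed.

Lemma kresE y : kres y = P u y - (kcoef *m (krow x y)^T) ord0 ord0.
Proof.
by rewrite /kres mxE; congr (_ - _); apply: eq_bigr => i _; rewrite !mxE symP.
Qed.

Lemma kres_node i : kres (x i) = 0.
Proof.
have /matrixP/(_ ord0 i) : kcoef *m gram x = krow x u by rewrite /kcoef mulmxKV.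
rewrite [LHS]mxE [RHS]mxE /kres => <-; apply/eqP; rewrite subr_eq0; apply/eqP.
by apply: eq_bigr => j _; congr (_ * _); rewrite mxE.
Qed.

(** By the reproducing property, vanishing at the nodes means orthogonality to every [P (x i)], so
    the squared norm reduces to the inner product with [P u]. *)
Lemma mean_kres_sqr : mean Q (fun y => kres y ^+ 2) = kres u.
Proof.
have [bk rk] := reproduces_kres.
transitivity (mean Q (fun y => P u y * kres y
    - \sum_(i < n) kcoef ord0 i * (P (x i) y * kres y))).
  apply: eq_mean => y; rewrite expr2 {1}/kres mulrBl mulr_suml.
  by congr (_ - _); apply: eq_bigr => i _; rewrite mulrA.
have bPk v : bmfun (fun y => P v y * kres y).
  by apply: bmfunM => //; exact: bkernel_row.
rewrite meanB//; last by apply: bmfun_sum => i; exact: bmfunZ.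
rewrite mean_sum; last by move=> i; exact: bmfunZ.
rewrite rk big1 ?subr0// => i _.
by rewrite meanZ// rk kres_node mulr0.
Qed.

End Residual.

(** The function [s] is the diagonal of the orthogonal projection onto the span of the [P (x i)].
    Its integral is [n], and [P u u - s u] is the squared norm of a residual. *)
Lemma gram_size_le n (x : 'I_n -> X) : gram x \in unitmx ->
  n%:R <= mean Q (fun u => P u u).
Proof.
move=> unitG; set Gi := invmx (gram x).
pose s u := \sum_(i < n) \sum_(j < n) Gi j i * (P u (x j) * P (x i) u).
have bs1 i : forall j, bmfun (fun u => Gi j i * (P u (x j) * P (x i) u)).
  by move=> j; apply/bmfunZ/bmfunM; [exact: bkernel_col | exact: bkernel_row].
have bs : bmfun s.
  by apply: bmfun_sum => i; apply: bmfun_sum => j; exact: bs1.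
have -> : n%:R = mean Q s.
  rewrite /s mean_sum; last by move=> i; exact: bmfun_sum.
  transitivity (\tr (gram x *m Gi)); first by rewrite mulmxV// mxtrace1.
  apply: eq_bigr => i _; rewrite mean_sum// mxE; apply: eq_bigr => j _.
  rewrite meanZ; last by apply: bmfunM; [exact: bkernel_col | exact: bkernel_row].
  rewrite mulrC; congr (_ * _); rewrite mxE -idemP.
  by apply: eq_mean => u; rewrite mulrC.
apply: le_mean => //; first exact: bkernel_diag.
move=> u; rewrite -subr_ge0.
have -> : P u u - s u = kres x u u.
  rewrite /kres /s; congr (_ - _); apply: eq_bigr => i _.
  rewrite mxE mulr_suml; apply: eq_bigr => j _.
  by rewrite !mxE mulrA (mulrC (Gi _ _)).
by rewrite -mean_kres_sqr//; apply: mean_ge0 => y; exact: sqr_ge0.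
Qed.

Definition kcons n (u : X) (x : 'I_n -> X) (i : 'I_(1 + n)) : X :=
  match fintype.split i with inl _ => u | inr j => x j end.

Lemma gram_kcons n (u : X) (x : 'I_n -> X) : gram (kcons u x) =
  block_mx (P u u)%:M (krow x u) (krow x u)^T (gram x).
Proof.
apply/matrixP => i j; rewrite !mxE /kcons.
case: fintype.splitP => i' _; rewrite !mxE; case: fintype.splitP => j' _; rewrite ?mxE//.
by rewrite !ord1 eqxx mulr1n.
Qed.

Lemma det_gram_kcons n (u : X) (x : 'I_n -> X) : gram x \in unitmx ->
  \det (gram (kcons u x)) = kres x u u * \det (gram x).
Proof.
move=> unitG.
(* A unipotent factor on the left clears the upper right block; the corner left over is the Schur
   complement [kres x u u]. *)
have detE : \det (block_mx (1%:M : 'M[R]_1) (- kcoef x u) 0 1%:M) = 1.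
  by rewrite det_ublock !det1 mulr1.
rewrite -[LHS]mul1r -{}detE -det_mulmx gram_kcons mulmx_block.
rewrite !mul1mx !mul0mx !add0r !mulNmx /kcoef mulmxKV// subrr.
rewrite det_lblock; congr (_ * _); rewrite det_mx11 !mxE eqxx mulr1n.
by rewrite kresE [X in _ = _ - X]mxE.
Qed.

(** Take a family of nodes with invertible Gram matrix of maximal size, which the trace bounds. A
    nonzero residual at [u] would allow [u] to be added, so all residuals vanish. *)
Lemma kernel_finite_rank : exists n (x : 'I_n -> X), gram x \in unitmx /\
  forall u y, P u y = (kcoef x u *m (krow x y)^T) ord0 ord0.
Proof.
pose p n := `[< exists x : 'I_n -> X, gram x \in unitmx >].
have p0 : exists n, p n.
  exists 0%N; apply/asboolP; unshelve eexists; first by case.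
  by rewrite unitmxE det_mx00 unitr1.
have pM n : p n -> (n <= Num.truncn (mean Q (fun u => P u u)))%N.
  move=> /asboolP[x /gram_size_le nm].
  by rewrite truncn_ge_nat// (le_trans _ nm).
have [n /asboolP[x unitG] nmax] := ex_maxnP p0 pM.
exists n, x; split=> // u y.
have /eqP : kres x u u = 0.
  apply/eqP/negPn/negP => r0.
  suff /nmax : p n.+1 by rewrite ltnn.
  apply/asboolP; exists (kcons u x); rewrite unitmxE det_gram_kcons//.
  by rewrite unitrM unitfE r0 -unitmxE.
rewrite -mean_kres_sqr// => /eqP r0.
have := reproduces_eq0 (reproduces_kres x u) r0 y.
by rewrite kresE => /eqP; rewrite subr_eq0 => /eqP.
Qed.

End ReproducingKernel.

Section KernelEigenfunction.
Context {R : realType} d (X : measurableType d) (Q : probability X R).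
Variables (P : X -> X -> R) (bP : bkernel P) (symP : forall x y, P x y = P y x).
Hypothesis idemP : kcomp Q P P =2 P.
Hypothesis P_neq0 : exists u, P u u != 0.
Variable T : X -> X.
Hypothesis invP : forall x y, P (T x) (T y) = P x y.

(* In coordinates [T] acts on the finite-dimensional range of [P] by an
   invertible matrix, and any eigenvector of it gives an eigenfunction. *)
Lemma kernel_eigenfunction : exists n (x : 'I_n -> X) (v : 'I_n -> R[i]) (lam : R[i]),
  let f u := \sum_(j < n) v j * (P (x j) u)%:C%C in
  (forall u, f (T u) = lam * f u) /\ exists u, f u != 0.
Proof.
have [n [x [unitG PE]]] := kernel_finite_rank bP symP idemP.
(* The finite rank formula at [(T u, T (x i))] combined with invariance reads
   [krow P x (T u) *m H = krow P x u]. Taking [u] among the nodes then factors the Gram matrix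
   through [H], which is therefore invertible. *)
pose Y : 'M[R]_n := \matrix_(i, j) P (T (x i)) (x j).
pose H := invmx (gram P x) *m Y^T.
have gH u : krow P x (T u) *m H = krow P x u.
  apply/rowP => i; rewrite [RHS]mxE -invP PE /kcoef /H mulmxA.
  by rewrite [LHS]mxE [RHS]mxE; apply: eq_bigr => j _; rewrite !mxE.
have YH : Y *m H = gram P x.
  apply/row_matrixP => i; rewrite row_mul.
  have -> : row i Y = krow P x (T (x i)) by apply/rowP => j; rewrite !mxE.
  by rewrite gH; apply/rowP => j; rewrite !mxE.
have unitH : H \in unitmx by move: unitG; rewrite -YH unitmx_mul => /andP[].
have gT u : krow P x (T u) = krow P x u *m invmx H by rewrite -(gH u) mulmxK.
have n_gt0 : (0 < n)%N.
  have [u Pu] := P_neq0; rewrite lt0n; apply: contra Pu => /eqP n0.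
  by rewrite PE mxE big1// => i; have : (i < 0)%N by rewrite -n0.
pose A := map_mx (real_complex R) (invmx H).
(* The transpose appears because [T] multiplies the row [g u] on the right by [A], while [v] is
   paired with the column [(g u)^T]. *)
have [lam /eigenvalueP[v vA v0]] := spectral.eigenvalue_closed A^T n_gt0.
pose g u := map_mx (real_complex R) (krow P x u).
have fE u : \sum_(j < n) v ord0 j * (P (x j) u)%:C%C = (v *m (g u)^T) ord0 ord0.
  by rewrite mxE; apply: eq_bigr => j _; rewrite !mxE symP.
exists n, x, (v ord0), lam; split => [u|].
  rewrite !fE /g gT map_mxM trmx_mul mulmxA vA -scalemxAl.
  by rewrite mxE.
(* Vanishing at the nodes alone already gives [v] times the Gram matrix equal to 0. *)
apply: contrapT => /forallNP f0.
have : v *m map_mx (real_complex R) (gram P x) = 0.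
  apply/rowP => j; rewrite [RHS]mxE mxE.
  have /negP := f0 (x j); rewrite negbK => /eqP fj; rewrite -[RHS]fj.
  by apply: eq_bigr => i _; rewrite !mxE.
move/(congr1 (mulmx^~ (invmx (map_mx (real_complex R) (gram P x))))).
rewrite mulmxK ?map_unitmx// mul0mx => v00.
by rewrite v00 eqxx in v0.
Qed.

(** The real and imaginary parts of the eigenfunction lie in the range of [P], so they have mean
    zero; if almost surely constant they are almost surely zero, hence zero everywhere by
    reproduction. *)
Lemma kernel_eigenfunction_contra :
  (forall x, mean Q (P x) = 0) ->
  ~ (forall (f : X -> R[i]) (lam : R[i]), cmeasurable f ->
      (forall x, f (T x) = lam * f x) ->
      exists c, Q.-negligible [set x | f x <> c]).
Proof.
move=> P0 H.
have [n [x [v [lam [fT [u fu]]]]]] := kernel_eigenfunction.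
set f := fun u => \sum_(j < n) v j * (P (x j) u)%:C%C.
have lincomb0 (a : 'I_n -> R) c :
    Q.-negligible [set u | \sum_(i < n) a i * P (x i) u <> c] ->
    forall u, \sum_(i < n) a i * P (x i) u = 0.
  pose h u := \sum_(i < n) a i * P (x i) u; move=> hc; have rh : reproduces Q P h.
    exact: reproduces_lincomb.
  have [bh _] := rh.
  have hc' : Q.-negligible [set u | h u != cst c u].
    by apply: negligibleS hc => y /= /eqP.
  have := eq_mean_negligible bh (bmfun_cst X c) hc'.
  rewrite mean_cst mean_sum; last by move=> i; exact/bmfunZ/bkernel_row.
  rewrite big1; last first.
    by move=> i _; rewrite meanZ ?P0 ?mulr0//; exact: bkernel_row.
  move=> c0; apply: (reproduces_eq0 bP rh).
  rewrite -[RHS](mean_cst Q 0); apply: eq_mean_negligible.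
  - exact: bmfunM.
  - exact: bmfun_cst.
  - by apply: negligibleS hc' => y /=; rewrite sqrf_eq0 -c0.
have ReE u' : complex.Re (f u') = \sum_(i < n) complex.Re (v i) * P (x i) u'.
  rewrite raddf_sum; apply: eq_bigr => i _.
  by case: (v i) => a b /=; rewrite mulr0 subr0.
have ImE u' : complex.Im (f u') = \sum_(i < n) complex.Im (v i) * P (x i) u'.
  rewrite raddf_sum; apply: eq_bigr => i _.
  by case: (v i) => a b /=; rewrite mulr0 add0r.
have mf : cmeasurable f.
  split.
    rewrite (funext ReE : (fun y => complex.Re (f y)) = _).
    by have [[]] := reproduces_lincomb bP symP idemP (fun i => complex.Re (v i)) x.
  rewrite (funext ImE : (fun y => complex.Im (f y)) = _).
  by have [[]] := reproduces_lincomb bP symP idemP (fun i => complex.Im (v i)) x.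
have [c fc] := H f lam mf fT.
move/eqP : fu; apply; apply/eqP; rewrite eq_complex /= ReE ImE; apply/andP; split.
- apply/eqP/(lincomb0 _ (complex.Re c)); apply: negligibleS fc => y /= + fy.
  by rewrite -ReE fy.
- apply/eqP/(lincomb0 _ (complex.Im c)); apply: negligibleS fc => y /= + fy.
  by rewrite -ImE fy.
Qed.

End KernelEigenfunction.

(** * Weak mixing from the absence of nonconstant eigenfunctions *)

Section WeakMixing.
Context {R : realType} d (X : measurableType d) (Q : probability X R).
Variable T : X -> X.
Hypotheses (mT : measurable_fun setT T)
  (QT : forall A, measurable A -> Q (T @^-1` A) = Q A).
Hypothesis eigen_cst : forall (f : X -> R[i]) (lam : R[i]), cmeasurable f ->
  (forall x, f (T x) = lam * f x) -> exists c, Q.-negligible [set x | f x <> c].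

Lemma invariant_bmfun_cst (u : X -> R) : bmfun u -> (forall x, u (T x) = u x) ->
  Q.-negligible [set x | u x != mean Q u].
Proof.
move=> bu uT.
have [||c uc] := @eigen_cst (fun x => (u x)%:C%C) 1.
- by split => /=; [case: bu | exact: measurable_cst].
- by move=> x; rewrite uT mul1r.
have uc' : Q.-negligible [set x | u x != cst (complex.Re c) x].
  by apply: negligibleS uc => x /= + ux; rewrite -ux /= eqxx.
by rewrite (eq_mean_negligible bu (bmfun_cst _ _) uc') mean_cst.
Qed.

Lemma mean_eq0_negligible (f g : X -> R) : bmfun f -> bmfun g ->
  Q.-negligible [set x | g x != 0] -> mean Q (fun x => f x * g x) = 0.
Proof.
move=> bf bg g0; rewrite -[RHS](mean_cst Q 0); apply: eq_mean_negligible.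
- exact: bmfunM.
- exact: bmfun_cst.
- by apply: negligibleS g0 => x /=; apply: contra => /eqP ->; rewrite mulr0.
Qed.

Lemma prob_weakly_mixing_eigen : prob_weakly_mixing T Q.
Proof.
split=> // E mE ET.
pose a := mean (Q \x Q)%E (\1_E : X * X -> R).
have aE : (Q \x Q)%E E = a%:E.
  rewrite /a /mean /Rintegral integral_indic// setIT fineK//.
  exact: fin_num_measure.
have [a0|a0] := eqVneq a 0; first by left; rewrite aE a0.
have [a1|a1] := eqVneq a 1; first by right; rewrite aE a1.
exfalso.
have bE : bmfun (\1_E : X * X -> R) by exact: bmfun_indic.
pose k x y : R := \1_E (x, y) - a.
have bk : bkernel k.
  rewrite /bkernel (_ : (fun z => _) = (fun z => \1_E z - a)).
    by apply: bmfunB => //; exact: bmfun_cst.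
  by apply/funext => -[].
have bkt := bkernel_tr bk.
have kT x y : k (T x) (T y) = k x y.
  rewrite /k; congr (_ - _); rewrite -[in RHS]ET !indicE.
  by congr (_%:R); congr nat_of_bool; apply/idP/idP; rewrite !inE.
have k_mean0 : mean (Q \x Q)%E (fun z => k z.1 z.2) = 0.
  rewrite (_ : (fun z => _) = (fun z => \1_E z - a)).
    by rewrite meanB ?mean_cst ?subrr//; exact: bmfun_cst.
  by apply/funext => -[].
pose w y := mean Q (k ^~ y).
have bw : bmfun w by apply: (@bmfun_kmean _ _ _ Q (fun y x => k x y)).
(* The marginal is invariant under [T], hence almost surely equal to its mean, which is the mean of
   [k]. *)
have w0 : Q.-negligible [set y | w y != 0].
  have -> : 0 = mean Q w.
    by rewrite -k_mean0 mean_prod//= mean_kswap.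
  apply: invariant_bmfun_cst => // y.
  rewrite /w -(mean_comp_invariant mT QT); last exact: bkernel_col.
  by apply: eq_mean => x; rewrite kT.
pose K := kcomp Q k (fun x y => k y x).
have bK : bkernel K by exact: bkernel_kcomp.
have symK x y : K x y = K y x by apply: eq_mean => z; rewrite mulrC.
have KT x y : K (T x) (T y) = K x y.
  rewrite /K /kcomp -(mean_comp_invariant mT QT).
    by apply: eq_mean => z; rewrite !kT.
  by apply: bmfunM; exact: bkernel_row.
(* Integrating [K x] pairs [k x] with the marginal [w]; the result is zero at every [x], although
   [w] vanishes only almost everywhere. *)
have K0 x : mean Q (K x) = 0.
  transitivity (mean Q (fun z => k x z * w z)); last first.
    by apply: mean_eq0_negligible => //; exact: bkernel_row.
  rewrite /K /kcomp (@mean_kswap _ _ _ Q (fun y z => k x z * k y z)).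
    by apply: eq_mean => z; rewrite meanZ//; exact: bkernel_col.
  by apply: bkernelM => //; apply: bkernel_right; exact: bkernel_row.
have K_neq0 : kdot Q K K != 0.
  apply/eqP => /(kdot_eq0_of_gram bk) kk0.
  have : a * (1 - a) = 0.
    rewrite -kk0 /kdot.
    (* Expansion of [(1_E - a)^2], using that an indicator is its own square. *)
    transitivity (mean (Q \x Q)%E (fun z => (1 - 2 * a) * \1_E z + a ^+ 2)).
      rewrite meanD; [|exact: bmfunZ|exact: bmfun_cst].
      by rewrite meanZ// mean_cst -/a; ring.
    apply: eq_mean => -[x y] /=; rewrite /k !indicE.
    by case: (_ \in _); rewrite /= ?mulr1n ?mulr0n; ring.
  move/eqP; rewrite mulf_eq0 (negbTE a0) subr_eq0 eq_sym.
  by rewrite (negbTE a1).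
have [P [bP symP idemP P_gt0 [P0 PT]]] := kernel_projection bK symK K_neq0.
apply: (kernel_eigenfunction_contra bP symP idemP _ (PT T mT QT KT) (P0 K0)) => //.
apply: contrapT => /forallNP nP.
move: P_gt0; rewrite (_ : (fun x => P x x) = (fun=> 0)) ?mean_cst ?ltxx//.
by apply/funext => x; have /negP := nP x; rewrite negbK => /eqP.
Qed.

End WeakMixing.

(** * Invariant probabilities *)

Section FineProbability.
Context {R : realType} d (X : measurableType d) (P : probability X R).
Implicit Types A B : set X.

Lemma fine_prob A : measurable A -> (fine (P A))%:E = P A.
Proof. by move=> mA; rewrite fineK//; exact: fin_num_measure. Qed.

Lemma fine_prob_ge0 A : 0 <= fine (P A).
Proof. exact: fine_ge0. Qed.

Lemma fine_prob_setT : fine (P setT) = 1.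
Proof. by rewrite probability_setT. Qed.

Lemma fine_probU A B : measurable A -> measurable B -> A `&` B = set0 ->
  fine (P (A `|` B)) = fine (P A) + fine (P B).
Proof. by move=> mA mB AB; rewrite measureU// fineD//; exact: fin_num_measure. Qed.

Lemma fine_probDI A B : measurable A -> measurable B ->
  fine (P A) = fine (P (A `\` B)) + fine (P (A `&` B)).
Proof.
move=> mA mB; rewrite (measureDI P mA mB) fineD//; apply: fin_num_measure.
  exact: measurableD.
exact: measurableI.
Qed.

Lemma fine_probC A : measurable A -> fine (P (~` A)) = 1 - fine (P A).
Proof. by move=> mA; rewrite probability_setC// fineB//; exact: fin_num_measure. Qed.

Lemma fine_prob_le A B : measurable A -> measurable B -> A `<=` B ->
  fine (P A) <= fine (P B).
Proof.
move=> mA mB AB; apply: fine_le; try exact: fin_num_measure.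
by apply: le_measure => //; rewrite inE.
Qed.

Lemma fine_prob_le1 A : measurable A -> fine (P A) <= 1.
Proof. by move=> mA; rewrite -fine_prob_setT fine_prob_le. Qed.

Lemma fine_prob_bigcup (F : (set X)^nat) : (forall n, measurable (F n)) ->
  nondecreasing_seq F ->
  (fun n => fine (P (F n))) @ \oo --> fine (P (\bigcup_n F n)).
Proof.
move=> mF ndF; have mUF : measurable (\bigcup_n F n) by exact: bigcup_measurable.
apply: fine_cvg; rewrite fine_prob//; exact: nondecreasing_cvg_mu.
Qed.

End FineProbability.

(** * Strictly invariant sets from almost invariant ones *)

Section InfinitelyOften.
Context d (X : measurableType d) (T : X -> X) (mT : measurable_fun setT T).

Lemma measurable_iter n : measurable_fun setT (iter n T).
Proof.
elim: n => [|n IH]; first exact: measurable_id.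
exact: (measurableT_comp mT IH).
Qed.

Lemma measurable_preimage_iter n A : measurable A ->
  measurable (iter n T @^-1` A).
Proof. by move=> mA; rewrite -[X in measurable X]setTI; exact: measurable_iter. Qed.

Definition ever (A : set X) : set X := \bigcup_k (iter k T @^-1` A).

(** The limsup of the preimages of [A]. It is strictly invariant whatever [A] is, so hypotheses on
    strictly invariant sets can be applied to sets invariant only off a null set. *)
Definition inf_often (A : set X) : set X := \bigcap_n (iter n T @^-1` ever A).

Lemma measurable_ever A : measurable A -> measurable (ever A).
Proof. by move=> mA; apply: bigcup_measurable => k _; exact: measurable_preimage_iter. Qed.

Lemma ever_preimage A x : ever A (T x) -> ever A x.
Proof. by move=> [k _ /=]; rewrite -iterSr => Ak; exists k.+1. Qed.

Lemma sub_ever A : A `<=` ever A.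
Proof. by move=> x Ax; exists 0%N. Qed.

Lemma inf_often_invariant A : measurable A -> invariant_set T (inf_often A).
Proof.
move=> mA; split.
  by apply: bigcap_measurable => // n _; exact/measurable_preimage_iter/measurable_ever.
apply/seteqP; split => x /= h n _ /=.
  by apply: ever_preimage; rewrite -iterS iterSr; exact: h.
by rewrite -iterSr; exact: h.
Qed.

(** An orbit starting off [N] stays off [N], and membership in [A] is constant along it. *)
Lemma inf_oftenE A N x : (forall z, ~ N z -> ~ N (T z)) ->
  (forall z, ~ N z -> (A (T z) <-> A z)) -> ~ N x -> (inf_often A x <-> A x).
Proof.
move=> NT AT Nx.
have iN k : ~ N (iter k T x) by elim: k => //= k; exact: NT.
have iA k : A (iter k T x) <-> A x by elim: k => //= k <-; exact: AT.
split => [/(_ 0%N I) [k _ /iA]//|Ax n _ /=].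
by apply: sub_ever; apply/iA.
Qed.

End InfinitelyOften.

Section InvariantUniqueness.
Context {R : realType} d (X : measurableType d) (T : X -> X).
Hypothesis mT : measurable_fun setT T.
Variables Q1 Q2 : probability X R.
Hypotheses (Q1T : forall A, measurable A -> Q1 (T @^-1` A) = Q1 A)
  (Q2T : forall A, measurable A -> Q2 (T @^-1` A) = Q2 A)
  (Q12 : forall A, invariant_set T A -> Q1 A = Q2 A).

Let f A := fine (Q1 A) - fine (Q2 A).

Let f_iter n A : measurable A -> f (iter n T @^-1` A) = f A.
Proof.
move=> mA; elim: n => // n IH; rewrite -{}IH /f.
have -> : iter n.+1 T @^-1` A = T @^-1` (iter n T @^-1` A).
  by apply/seteqP; split => x /=; rewrite -iterS iterSr.
by rewrite Q1T ?Q2T//; exact: measurable_preimage_iter.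
Qed.

Let fU A B : measurable A -> measurable B ->
  f (A `|` B) = f A + f B - f (A `&` B).
Proof.
move=> mA mB; have mD := measurableD mB mA.
have mI := measurableI B A mB mA.
have h (P : probability X R) :
    fine (P (A `|` B)) = fine (P A) + fine (P B) - fine (P (A `&` B)).
  rewrite (_ : A `|` B = A `|` (B `\` A)); last first.
    by apply/seteqP; split => x /=; have [] := pselect (A x); tauto.
  rewrite fine_probU//; last by rewrite setDE setICA setICr setI0.
  by rewrite (fine_probDI P mB mA) setIC; ring.
by rewrite /f !h; ring.
Qed.

Let fC A : measurable A -> f (~` A) = - f A.
Proof. by move=> mA; rewrite /f !fine_probC//; ring. Qed.

Let f_bigcup (F : (set X)^nat) M : (forall n, measurable (F n)) ->
  nondecreasing_seq F -> (forall n, f (F n) = M) -> f (\bigcup_n F n) = M.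
Proof.
move=> mF ndF FM.
have h : (fun=> M) @ \oo --> f (\bigcup_n F n).
  rewrite (_ : (fun=> M) = fun n => fine (Q1 (F n)) - fine (Q2 (F n))).
    by apply: cvgB; exact: fine_prob_bigcup.
  by apply/funext => n; rewrite -(FM n).
exact: (cvg_unique (@Rhausdorff R) h (cvg_cst _)).
Qed.

Let f_bigcap (F : (set X)^nat) M : (forall n, measurable (F n)) ->
  nonincreasing_seq F -> (forall n, f (F n) = M) -> f (\bigcap_n F n) = M.
Proof.
move=> mF niF FM; apply: oppr_inj; rewrite -fC; last exact: bigcap_measurable.
rewrite setC_bigcap; apply: f_bigcup.
- by move=> n; exact: measurableC.
- by move=> m n mn; apply/subsetPset/subsetC/subsetPset/niF.
- by move=> n; rewrite fC// FM.
Qed.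

(** The positive set of a Hahn decomposition of the signed measure [Q1 - Q2]. *)
Let hahn : exists2 D, measurable D & forall A, measurable A -> f A <= f D.
Proof.
pose nu := cadd (charge_of_finite_measure Q1) (copp (charge_of_finite_measure Q2)).
have nuE A : measurable A -> nu A = (f A)%:E.
  by move=> mA; rewrite /nu /cadd /copp /= /charge_of_finite_measure /f
    EFinB !fine_prob.
have [D [N [[mD posD] [mN negN] DN DN0]]] := Hahn_decomposition nu.
exists D => // A mA.
have split2 A' : measurable A' -> f A' = f (A' `\` D) + f (A' `&` D).
  by move=> mA'; rewrite /f !(fine_probDI _ mA' mD); ring.
have le1 : f (A `\` D) <= 0.
  rewrite -lee_fin -nuE; last exact: measurableD.
  apply: negN; first exact: measurableD.
  by move=> x [_ Dx]; have [] : (D `|` N) x by rewrite DN.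
have le2 : 0 <= f (D `\` A).
  rewrite -lee_fin -nuE; last exact: measurableD.
  by apply: posD; [exact: measurableD | exact: subDsetl].
have : f D = f (D `\` A) + f (D `&` A).
  by rewrite /f !(fine_probDI _ mD mA); ring.
by rewrite (split2 _ mA) (setIC D A) => ->; lra.
Qed.

(* The sets maximizing [Q1 - Q2] are stable under preimages by [T], finite unions
   and monotone limits, so the maximum is reached at an invariant set. *)
Lemma invariant_prob_le A : measurable A -> fine (Q1 A) <= fine (Q2 A).
Proof.
have [D mD maxD] := hahn.
pose U n := [set x | exists2 k, (k <= n)%N & D (iter k T x)].
have US n : U n.+1 = U n `|` (iter n.+1 T @^-1` D).
  apply/seteqP; split => x /=.
    move=> [k]; rewrite leq_eqVlt => /orP[/eqP -> |kn] Dk; [by right|].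
    by left; exists k.
  by case=> [[k kn Dk]|Dn]; [exists k => //; exact: leqW | exists n.+1].
have U0 : U 0%N = D.
  apply/seteqP; split => x /=; last by exists 0%N.
  by move=> [k]; rewrite leqn0 => /eqP ->.
have mU n : measurable (U n).
  elim: n => [|n IH]; first by rewrite U0.
  by rewrite US; apply: measurableU => //; exact: measurable_preimage_iter.
have fUn n : f (U n) = f D.
  elim: n => [|n IH]; first by rewrite U0.
  apply/le_anti; rewrite maxD//=.
  have mDn := measurable_preimage_iter mT n.+1 mD.
  (* Both sets of the union reach the maximum and their intersection does not exceed it, so the
     union reaches it by modularity of [f]. *)
  have := maxD _ (measurableI _ _ (mU n) mDn).
  by rewrite US fU// IH f_iter//; lra.
have UE : \bigcup_n U n = ever T D.
  apply/seteqP; split => x [n _] /=; first by move=> [k _ Dk]; exists k.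
  by move=> Dn; exists n => //; exists n.
have fev : f (ever T D) = f D.
  rewrite -UE; apply: f_bigcup => // m n mn; apply/subsetPset => x [k km Dk].
  by exists k => //; exact: leq_trans mn.
have mev := measurable_ever mT mD.
have fio : f (inf_often T D) = f D.
  apply: f_bigcap.
  - by move=> n; exact: measurable_preimage_iter.
  - apply/nonincreasing_seqP => n; apply/subsetPset => x /=.
    exact: ever_preimage.
  - by move=> n; rewrite f_iter.
(* The maximum of [f] is its value at an invariant set, where [Q1] and [Q2] agree, so it is 0. *)
move=> mA; rewrite -subr_le0 (le_trans (maxD _ mA))// -fio.
by rewrite /f Q12 ?subrr//; exact: inf_often_invariant.
Qed.

End InvariantUniqueness.

Lemma invariant_prob_unique {R : realType} d (X : measurableType d) (T : X -> X)
    (Q1 Q2 : probability X R) : measurable_fun setT T ->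
  (forall A, measurable A -> Q1 (T @^-1` A) = Q1 A) ->
  (forall A, measurable A -> Q2 (T @^-1` A) = Q2 A) ->
  (forall A, invariant_set T A -> Q1 A = Q2 A) ->
  forall A, measurable A -> Q1 A = Q2 A.
Proof.
move=> mT Q1T Q2T Q12 A mA; rewrite -(fine_prob Q1 mA) -(fine_prob Q2 mA).
congr EFin; apply/le_anti; rewrite (invariant_prob_le mT Q1T Q2T Q12 mA).
by apply: (invariant_prob_le mT Q2T Q1T _ mA) => B /Q12 ->.
Qed.

(** * Upper probabilities *)

(** Compactness of the interval yields a cluster point, and an ultrafilter converges to each of its
    cluster points. *)
Lemma ultra_cvg_bounded {R : realType} (G : set_system nat) (u : nat -> R) (M : R) :
  UltraFilter G -> (forall n, `|u n| <= M) -> cvg (u @ G).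
Proof.
move=> GU uM; have GP : ProperFilter G by exact: ultra_proper.
have [p [_ clp]] : `[- M, M]%classic `&` cluster (u @ G) !=set0.
  apply: (@segment_compact R).
  apply: (@filterS _ G _ setT) => [n _ /=|]; last exact: filterT.
  by rewrite in_itv /= -ler_norml uM.
apply/cvg_ex; exists p => U Up /=.
have [//|GnU] := in_ultra_setVsetC (u @^-1` U) GU.
have [y [nUy Uy]] := clp (~` U) U GnU Up.
by [].
Qed.

Section ProbabilityOfContent.
Context {R : realType} d (X : measurableType d) (q : set X -> R).
Hypotheses (qT : q setT = 1) (q_ge0 : forall A, measurable A -> 0 <= q A)
  (qU : forall A B, measurable A -> measurable B -> A `&` B = set0 ->
    q (A `|` B) = q A + q B)
  (q_cvg0 : forall F : (set X)^nat, (forall n, measurable (F n)) ->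
    nonincreasing_seq F -> \bigcap_n F n = set0 -> q (F n) @[n --> \oo] --> 0).

Let q0 : q set0 = 0.
Proof.
have := qU measurable0 measurable0 (setI0 _); rewrite setU0.
by move/eqP; rewrite -subr_eq0 opprD addrA subrr sub0r oppr_eq0 => /eqP.
Qed.

(** Nothing is known of [q] off the measurable sets; the value 0 there makes [mu] nonnegative on all
    sets. *)
Let mu A : \bar R := if `[< measurable A >] then (q A)%:E else 0%E.

Let muE A : measurable A -> mu A = (q A)%:E.
Proof. by move=> mA; rewrite /mu; case: asboolP. Qed.

Let mu0 : mu set0 = 0%E. Proof. by rewrite muE// q0. Qed.

Let mu_ge0 A : (0 <= mu A)%E.
Proof. by rewrite /mu; case: asboolP => // mA; rewrite lee_fin q_ge0. Qed.

Let mu_sigma : semi_sigma_additive mu.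
Proof.
move=> F mF tF mUF.
(* The tails decrease to the empty set, so finite additivity and [q_cvg0] give countable
   additivity. *)
pose H n := \bigcup_k F k `\` \big[setU/set0]_(i < n) F i.
have mB n : measurable (\big[setU/set0]_(i < n) F i) by exact: bigsetU_measurable.
have mH n : measurable (H n) by exact: measurableD.
have sumE n : (\sum_(0 <= i < n) mu (F i) = (q (\big[setU/set0]_(i < n) F i))%:E)%E.
  elim: n => [|n IH]; first by rewrite big_geq// big_ord0 q0.
  rewrite big_nat_recr//= IH muE// -EFinD big_ord_recr/= qU//.
    exact: mB.
  rewrite -subset0 -bigcup_mkord => x [[k /= kn Fk] Fn].
  by move: kn; rewrite (tF k n I I (ex_intro _ x (conj Fk Fn))) ltnn.
have qH n : q (\bigcup_k F k) = q (\big[setU/set0]_(i < n) F i) + q (H n).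
  rewrite -qU//; last by rewrite /H setDE setICA setICr setI0.
  congr q; rewrite /H setDUK// => x; rewrite -bigcup_mkord => -[k _ Fk].
  by exists k.
have H0 : q (H n) @[n --> \oo] --> 0.
  apply: q_cvg0 => //.
  - apply/nonincreasing_seqP => n; apply/subsetPset; apply: setDS.
    by rewrite big_ord_recr; exact: subsetUl.
  - rewrite -subset0 => x Hx; have [[k _ Fk] _] := Hx 0%N I.
    have [_] := Hx k.+1 I; apply; rewrite -bigcup_mkord.
    by exists k => /=.
rewrite muE// (_ : (fun n => _) = (fun n => (q (\bigcup_k F k) - q (H n))%:E)).
  apply: cvg_EFin; first exact: nearW.
  rewrite -[X in _ --> X]subr0; apply: cvgB => //; exact: cvg_cst.
by apply/funext => n; rewrite sumE (qH n) addrK.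
Qed.

HB.instance Definition _ := isMeasure.Build _ _ _ mu mu0 mu_ge0 mu_sigma.

Let muT : mu setT = 1%E. Proof. by rewrite muE// qT. Qed.

HB.instance Definition _ := Measure_isProbability.Build _ _ _ mu muT.

Lemma probability_of_content : exists Q : probability X R,
  forall A, measurable A -> Q A = (q A)%:E.
Proof. by exists (mu : probability X R) => A; exact: muE. Qed.

End ProbabilityOfContent.

Lemma setwise_evalE {R : realType} d (X : measurableType d)
    (P : probability X R) A : measurable A -> setwise_eval P A = fine (P A).
Proof. by move=> mA; rewrite /setwise_eval; case: asboolP. Qed.

Section UpperProbability.
Context {R : realType} d (X : measurableType d) (V : set X -> R).
Hypothesis HV : upper_probability V.

(** A Dini argument. If [V (F n) >= e] for all [n], maximizers [P_ n] satisfy [P_ n (F m) >= e] for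
    [n >= m]. A cluster point in the compact set inherits this for every [m], and its countable
    additivity forces [e <= 0]. *)
Lemma upper_probability_cvg0 (F : (set X)^nat) : (forall n, measurable (F n)) ->
  nonincreasing_seq F -> \bigcap_n F n = set0 -> V (F n) @[n --> \oo] --> 0.
Proof.
move=> mF niF F0; have [[V0 [V1 Vle]] [L [Lcompact LV]]] := HV.
have niV : nonincreasing_seq (V \o F).
  by move=> m n mn; apply: Vle => //; apply/subsetPset/niF.
have Vge0 n : 0 <= V (F n) by rewrite -V0; apply: Vle.
have cV : cvgn (V \o F).
  by apply: nonincreasing_is_cvgn => //; exists 0 => _ [n _ <-]; exact: Vge0.
suff V00 : limn (V \o F) <= 0.
  have -> : 0 = limn (V \o F).
    by apply/le_anti; rewrite V00 limr_ge//; exact: nearW.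
  exact: cV.
set e := limn _.
have eV n : e <= V (F n) by exact: (nonincreasing_cvgn_ge niV cV).
have /choice[P_ PP] : forall n, exists P, L P /\ fine (P (F n)) = V (F n).
  by move=> n; have [[P LP PV] _] := LV _ (mF n); exists P.
have FL : ((setwise_eval \o P_) @ \oo) (setwise_eval @` L).
  by exists 0%N => // n _; exists (P_ n) => //; exact: (PP n).1.
have [_ [[P LP <-] clP]] := Lcompact _ _ FL.
have ePF m : e <= fine (P (F m)).
  rewrite leNgt; apply/negP => lt_e.
  have Um : nbhs (setwise_eval P) [set phi : {ptws set X -> R} | phi (F m) < e].
    have cont : continuous (fun phi : {ptws set X -> R} => phi (F m)).
      exact: (@proj_continuous _ (fun=> R) (F m)).
    apply: (cont (setwise_eval P) [set r | r < e]).
    apply: open_nbhs_nbhs; split; first exact: open_lt.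
    by rewrite /= setwise_evalE.
  have Sm : ((setwise_eval \o P_) @ \oo) [set phi | e <= phi (F m)].
    exists m => // n mn /=; rewrite setwise_evalE//.
    rewrite (le_trans (eV n))// -(PP n).2; apply: fine_prob_le => //.
    exact/subsetPset/niF.
  have [phi [/= h1 h2]] := clP _ _ Sm Um.
  by have := le_lt_trans h1 h2; rewrite ltxx.
have PF0 : (fun n => fine (P (F n))) @ \oo --> (0 : R).
  apply: fine_cvg; rewrite (_ : 0%:E = P (\bigcap_n F n)); last by rewrite F0 measure0.
  apply: nonincreasing_cvg_mu => //; last exact: bigcap_measurable.
  by rewrite (le_lt_trans (probability_le1 P (mF 0%N)))// ltry.
by apply: (cvgr_to_ge PF0); exact: nearW.
Qed.

Variable T : X -> X.
Hypotheses (mT : measurable_fun setT T) (HVT : cap_T_invariant T V).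

Lemma cap_T_invariant_iter n A : measurable A -> V (iter n T @^-1` A) = V A.
Proof.
move=> mA; elim: n => // n IH; rewrite -{}IH.
have -> : iter n.+1 T @^-1` A = T @^-1` (iter n T @^-1` A).
  by apply/seteqP; split => x /=; rewrite -iterS iterSr.
by rewrite HVT//; exact: measurable_preimage_iter.
Qed.

(* A limit of Cesaro averages along an ultrafilter. *)
Lemma invariant_core : exists Q : probability X R,
  (forall A, measurable A -> Q (T @^-1` A) = Q A) /\
  core V (fun A => fine (Q A)).
Proof.
have [[V0 [V1 Vle]] [L [_ LV]]] := HV.
have [[P LP _] _] := LV _ measurableT.
have PV A : measurable A -> fine (P A) <= V A by move=> /LV[_]; exact.
pose avg A n : R := n.+1%:R^-1 * \sum_(k < n.+1) fine (P (iter k T @^-1` A)).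
have mi k A : measurable A -> measurable (iter k T @^-1` A).
  exact: measurable_preimage_iter.
have avg_ge0 A n : 0 <= avg A n.
  by rewrite mulr_ge0// ?invr_ge0// sumr_ge0// => k _; exact: fine_prob_ge0.
have avg_le A n M : (forall k, fine (P (iter k T @^-1` A)) <= M) -> avg A n <= M.
  move=> AM; rewrite /avg mulrC ler_pdivrMr ?ltr0n//.
  have -> : M * n.+1%:R = \sum_(k < n.+1) M by rewrite sumr_const card_ord mulr_natr.
  by apply: ler_sum => k _; exact: AM.
(* One ultrafilter serves all sets at once, which makes the limit additive. *)
have [G [GU ooG]] := ultraFilterLemma eventually_filter.
have GP : ProperFilter G by exact: ultra_proper.
have cavg A : measurable A -> cvg (avg A @ G).
  move=> mA; apply: (@ultra_cvg_bounded _ _ _ 1) => n.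
  rewrite ger0_norm// avg_le// => k; exact/fine_prob_le1/mi.
pose q A := lim (avg A @ G).
have q_ge0 A : measurable A -> 0 <= q A.
  by move=> mA; apply: limr_ge; [exact: cavg | exact: nearW].
have q_le A : measurable A -> q A <= V A.
  move=> mA; apply: limr_le; first exact: cavg.
  apply: nearW => n; apply: avg_le => k; rewrite -(cap_T_invariant_iter k mA).
  exact/PV/mi.
have qT : q setT = 1.
  rewrite /q (_ : avg setT = fun=> 1); first exact: lim_cst.
  apply/funext => n; rewrite /avg.
  under eq_bigr do rewrite preimage_setT fine_prob_setT.
  by rewrite sumr_const card_ord mulVf// pnatr_eq0.
have qU A B : measurable A -> measurable B -> A `&` B = set0 ->
    q (A `|` B) = q A + q B.
  move=> mA mB AB; rewrite /q -limD; try exact: cavg.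
  congr (lim (_ @ G)); apply/funext => n; rewrite /avg fctE -mulrDr -big_split/=.
  congr (_ * _); apply: eq_bigr => k _; rewrite preimage_setU fine_probU//.
  - exact: mi.
  - exact: mi.
  - by rewrite -preimage_setI AB preimage_set0.
have [||||Q QE] := @probability_of_content _ _ X q => //.
  (* Continuity at the empty set is inherited from [V] through [0 <= q <= V]. *)
  move=> F mF niF F0.
  apply: (squeeze_cvgr _ (cvg_cst 0) (upper_probability_cvg0 mF niF F0)).
  by apply: nearW => n; rewrite q_ge0 ?q_le.
have fQ A : measurable A -> fine (Q A) = q A by move=> mA; rewrite QE.
exists Q; split=> [A mA|].
  have mTA := mi 1%N A mA; rewrite !QE//; congr EFin; apply/eqP.
  rewrite -subr_eq0 /q -limB; try exact: cavg.
  apply/eqP/(cvg_lim (@Rhausdorff R)).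
  apply: (@cvg_trans _ ((avg (T @^-1` A) - avg A) @ \oo)).
    by move=> S /ooG.
  have n0 : (fun n => n.+1%:R^-1) @ \oo --> (0 : R) by exact: cvg_harmonic.
  have n0N : (fun n => - n.+1%:R^-1) @ \oo --> (0 : R).
    by rewrite -[X in _ --> X]oppr0; exact: cvgN.
  apply: (squeeze_cvgr _ n0N n0); apply: nearW => n /=.
  rewrite -ler_norml /avg !fctE -mulrBr normrM ger0_norm ?invr_ge0//.
  rewrite ler_piMr ?invr_ge0//.
  (* The sums telescope to the last term of one minus the first of the other, both in [[0,1]]; hence
     the bound [1/(n+1)]. *)
  rewrite big_ord_recr [X in _ - X]big_ord_recl/=.
  rewrite (_ : \sum_(i < n) _ = \sum_(i < n) fine (P (iter (bump 0 i) T @^-1` A))).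
    rewrite [X in `|X - _|]addrC opprD addrACA subrr addr0.
    rewrite -[X in _ - X]/(fine (P A)).
    rewrite ler_norml; apply/andP; split.
      have := fine_prob_le1 P mA; have := fine_prob_ge0 P (iter n T @^-1` (T @^-1` A)).
      lra.
    have := fine_prob_le1 P (mi n _ mTA); have := fine_prob_ge0 P A; lra.
  by apply: eq_bigr => i _; rewrite /bump leq0n.
split; first by rewrite fQ.
split; first by move=> A mA; rewrite fQ//; exact: q_ge0.
split; last by move=> A mA; rewrite fQ//; exact: q_le.
move=> A B mA mB /disj_set2P AB.
by rewrite !fQ//; [exact: qU | exact: measurableU].
Qed.

End UpperProbability.

(** * Almost sure eigenfunctions of a weakly mixing probability *)

Section AlmostSure.
Context {R : realType}.

Lemma measurable_ltr_set d (X : measurableType d) (f g : X -> R) :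
  measurable_fun setT f -> measurable_fun setT g ->
  measurable [set x | f x < g x].
Proof.
move=> mf mg; have := measurable_fun_ltr mf mg measurableT (Y := [set true]) I.
by rewrite setTI; congr measurable; apply/seteqP; split.
Qed.

Lemma negligible_exists d (X : measurableType d) (Q : probability X R)
    (N : set X) : Q.-negligible N -> exists x, ~ N x.
Proof.
move=> nN; apply: contrapT => /forallNP NN.
have : Q.-negligible setT.
  by apply: negligibleS nN => x _; apply: contrapT; exact: NN.
move/(negligibleP _ measurableT); rewrite /= probability_setT => /eqP.
by rewrite eqe oner_eq0.
Qed.

(** Fubini: the measures of the sections are nonnegative with integral zero. *)
Lemma negligible_xsection d (X : measurableType d) (Q : probability X R)
    (N : set (X * X)) : (Q \x Q)%E.-negligible N ->
  Q.-negligible [set x | ~ Q.-negligible (xsection N x)].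
Proof.
move=> [M [mM M0 NM]].
have mx : measurable_fun setT (Q \o xsection M) by exact: measurable_fun_xsection.
have : ae_eq Q setT (Q \o xsection M) (cst 0%E).
  apply/(ae_eq_integral_abs _ measurableT mx).
  rewrite -M0 /product_measure1.
  by apply: eq_integral => x _; rewrite gee0_abs.
apply: negligibleS => x /= h; apply/not_implyP; split => // Qx; apply: h.
exists (xsection M x); split => //; first exact: measurable_xsection.
by move=> y; rewrite /xsection /= !inE; exact: NM.
Qed.

(* A countable family of 0-1 events does not separate points off a null set. *)
Lemma zero_one_nonseparating d (Z : measurableType d) (m : probability Z R)
    (E : (set Z)^nat) : (forall n, measurable (E n)) ->
  (forall n, m (E n) = 0%E \/ m (E n) = 1%E) ->
  exists N, m.-negligible N /\
    forall z z', ~ N z -> ~ N z' -> forall n, E n z -> E n z'.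
Proof.
move=> mE E01; pose F n := if m (E n) == 0%E then E n else ~` E n.
exists (\bigcup_n F n); split.
  apply: negligible_bigcup => n; rewrite /F; case: eqP => [E0|nE0].
    exact/negligibleP.
  apply/negligibleP; first exact: measurableC.
  by rewrite /= probability_setC//; have [//|->] := E01 n; rewrite subee.
move=> z z' Fz Fz' n Enz; apply: contrapT => nE.
have [E0|nE0] := boolP (m (E n) == 0%E).
  by apply: Fz; exists n => //; rewrite /F E0.
by apply: Fz'; exists n => //; rewrite /F (negbTE nE0).
Qed.

End AlmostSure.

Section EigenfunctionConstant.
Context {R : realType} d (X : measurableType d) (Q : probability X R).
Variables (T : X -> X) (mT : measurable_fun setT T).
Hypothesis QT : prob_weakly_mixing T Q.
Variables (a b : X -> R) (s t : R).
Hypotheses (ma : measurable_fun setT a) (mb : measurable_fun setT b).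
Variable N : set X.
Hypotheses (nN : Q.-negligible N) (NT : forall x, ~ N x -> ~ N (T x)).
Hypotheses (st_neq0 : (s != 0) || (t != 0))
  (aT : forall x, ~ N x -> a (T x) = s * a x - t * b x)
  (bT : forall x, ~ N x -> b (T x) = s * b x + t * a x).

Let T2 (z : X * X) := (T z.1, T z.2).

Let mT2 : measurable_fun setT T2.
Proof.
by apply: measurable_fun_pair; exact: measurableT_comp.
Qed.

Let N2 : set (X * X) := [set z | N z.1 \/ N z.2].

Let nN2 : (Q \x Q)%E.-negligible N2.
Proof.
have [M [mM M0 NM]] := nN.
have {}M0 : Q M = 0%E := M0.
have n1 : (Q \x Q)%E.-negligible (M `*` setT).
  by apply/negligibleP; [exact: measurableX|rewrite /= product_measure1E//= M0 mul0e].
have n2 : (Q \x Q)%E.-negligible (setT `*` M).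
  by apply/negligibleP; [exact: measurableX|rewrite /= product_measure1E//= M0 mule0].
by apply: negligibleS (negligibleU n1 n2) => z [/NM|/NM]; [left|right].
Qed.

(* Meant for [l / r] the real or imaginary part of [f y / f x], where
   [f = a + i b] and [r (x, y) = |f x|^2]. *)
Let nonsep (l r : X * X -> R) : measurable_fun setT l -> measurable_fun setT r ->
  (forall z, ~ N2 z -> l (T2 z) = (s ^+ 2 + t ^+ 2) * l z) ->
  (forall z, ~ N2 z -> r (T2 z) = (s ^+ 2 + t ^+ 2) * r z) ->
  exists M, (Q \x Q)%E.-negligible M /\ forall z z', ~ M z -> ~ M z' ->
    0 < r z -> r z = r z' -> l z = l z'.
Proof.
move=> ml mr lT rT.
have st0 : 0 < s ^+ 2 + t ^+ 2.
  by case/orP: st_neq0 => h; [rewrite ltr_wpDr|rewrite ltr_wpDl];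
     rewrite ?sqr_ge0// lt_neqAle sqr_ge0 eq_sym sqrf_eq0 h.
(* The events [l / r < q] for rational [q], written without division; a code of no rational defaults
   to 0. *)
pose B (n : nat) := [set z : X * X |
  l z < ratr (odflt 0 (@unpickle rat n)) * r z].
have mB n : measurable (B n).
  by apply: measurable_ltr_set => //; apply: measurable_funM => //; exact: measurable_cst.
have BE n z : ~ N2 z -> (B n (T2 z) <-> B n z).
  move=> Nz; rewrite /B /= lT// rT// mulrCA ltr_pM2l//.
have N2T z : ~ N2 z -> ~ N2 (T2 z).
  move=> Nz [/=|/=]; apply: NT => h; apply: Nz; by [left|right].
(* The events [B n] are invariant only off [N2], while ergodicity of the product concerns strictly
   invariant sets. *)
pose E n := inf_often T2 (B n).
have invE n : invariant_set T2 (E n) by exact: inf_often_invariant.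
have [|n|M [nM HM]] := @zero_one_nonseparating _ _ _ (Q \x Q)%E E.
- by move=> n; case: (invE n).
- by have [mE ET] := invE n; apply: QT.2.
exists (M `|` N2); split; first exact: negligibleU.
have key z z' : ~ (M `|` N2) z -> ~ (M `|` N2) z' -> 0 < r z -> r z = r z' ->
    ~ (l z < l z').
  move=> Mz Mz' rz rzz' lzz'.
  have : l z / r z < l z' / r z by rewrite ltr_pM2r// invr_gt0.
  move/rat_in_itvoo => [q]; rewrite in_itv /= => /andP[q1 q2].
  have Bq w : B (pickle q) w <-> l w < ratr q * r w by rewrite /B /= pickleK.
  have Nz : ~ N2 z by move=> h; apply: Mz; right.
  have Nz' : ~ N2 z' by move=> h; apply: Mz'; right.
  have : B (pickle q) z'.
    apply/(inf_oftenE N2T (BE _) Nz'); apply: (HM z).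
    - by move=> h; apply: Mz; left.
    - by move=> h; apply: Mz'; left.
    - by apply/(inf_oftenE N2T (BE _) Nz)/Bq; rewrite -ltr_pdivrMr.
  move/Bq; rewrite -rzz' ltNge => /negP; apply.
  by rewrite -ler_pdivlMr// ltW.
move=> z z' Mz Mz' rz rzz'; apply/le_anti; rewrite !leNgt.
have rz' : 0 < r z' by rewrite -rzz'.
by apply/andP; split; apply/negP; [exact: (key z' z)|exact: (key z z')].
Qed.

(** Put [f = a + i b] and [lam = s + i t]. Then [l1] and [l2] are the real and imaginary parts of
    [f y] times the conjugate of [f x], and [T2] scales them and [r] by [|lam|^2]. Fixing a generic
    [x] with [f x] nonzero makes [f y] constant for almost all [y]. *)
Lemma eigenfunction_cst : exists c e, Q.-negligible [set x | a x <> c \/ b x <> e].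
Proof.
have m1 (h : X -> R) : measurable_fun setT h ->
    measurable_fun setT (fun z : X * X => h z.1).
  by move=> mh; exact: measurableT_comp.
have m2 (h : X -> R) : measurable_fun setT h ->
    measurable_fun setT (fun z : X * X => h z.2).
  by move=> mh; exact: measurableT_comp.
pose r (z : X * X) := a z.1 * a z.1 + b z.1 * b z.1.
pose l1 (z : X * X) := a z.2 * a z.1 + b z.2 * b z.1.
pose l2 (z : X * X) := b z.2 * a z.1 - a z.2 * b z.1.
have mr : measurable_fun setT r.
  by apply: measurable_funD; apply: measurable_funM; exact: m1.
have ml1 : measurable_fun setT l1.
  by apply: measurable_funD; apply: measurable_funM; (exact: m1 || exact: m2).
have ml2 : measurable_fun setT l2.
  by apply: measurable_funB; apply: measurable_funM; (exact: m1 || exact: m2).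
have nN12 z : ~ N2 z -> ~ N z.1 /\ ~ N z.2.
  by move=> nz; split => h; apply: nz; [left|right].
have rT z : ~ N2 z -> r (T2 z) = (s ^+ 2 + t ^+ 2) * r z.
  by move=> /nN12[n1 n2]; rewrite /r /T2 /= !aT// !bT//; ring.
have l1T z : ~ N2 z -> l1 (T2 z) = (s ^+ 2 + t ^+ 2) * l1 z.
  by move=> /nN12[n1 n2]; rewrite /l1 /T2 /= !aT// !bT//; ring.
have l2T z : ~ N2 z -> l2 (T2 z) = (s ^+ 2 + t ^+ 2) * l2 z.
  by move=> /nN12[n1 n2]; rewrite /l2 /T2 /= !aT// !bT//; ring.
have [M1 [nM1 H1]] := nonsep ml1 mr l1T rT.
have [M2 [nM2 H2]] := nonsep ml2 mr l2T rT.
have [f0|f0] := pselect (Q.-negligible [set x | a x <> 0 \/ b x <> 0]).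
  by exists 0, 0.
have [x [fx nx]] : exists x, (a x <> 0 \/ b x <> 0) /\
    Q.-negligible (xsection (M1 `|` M2) x).
  apply: contrapT => /forallNP h; apply: f0.
  apply: negligibleS (negligible_xsection (negligibleU nM1 nM2)) => x /= fx nx.
  by apply: (h x).
have rx : 0 < a x * a x + b x * b x.
  case: fx => /eqP h; [rewrite ltr_wpDr|rewrite ltr_wpDl]; rewrite -?expr2 ?sqr_ge0//;
  by rewrite lt_neqAle sqr_ge0 eq_sym sqrf_eq0 h.
have [y0 ny0] := negligible_exists nx.
exists (a y0), (b y0); apply: negligibleS nx => y /= fy.
apply: contrapT => ny.
have nM y' : ~ xsection (M1 `|` M2) x y' -> ~ M1 (x, y') /\ ~ M2 (x, y').
  by rewrite /xsection /= => h; split => h'; apply: h; rewrite inE; [left|right].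
have [ny1 ny2] := nM _ ny; have [ny01 ny02] := nM _ ny0.
have := H1 _ _ ny1 ny01 rx erefl; have := H2 _ _ ny2 ny02 rx erefl.
rewrite /l1 /l2 /= => e2 e1.
(* Multiplying [l1 + i l2] by [f x] gives [|f x|^2 f y], whose real and imaginary parts are compared
   in turn. *)
have ea : (a x * a x + b x * b x) * a y = (a x * a x + b x * b x) * a y0.
  transitivity (a x * (a y * a x + b y * b x) - b x * (b y * a x - a y * b x)).
    by ring.
  by rewrite e1 e2; ring.
have eb : (a x * a x + b x * b x) * b y = (a x * a x + b x * b x) * b y0.
  transitivity (b x * (a y * a x + b y * b x) + a x * (b y * a x - a y * b x)).
    by ring.
  by rewrite e1 e2; ring.
have rx0 := lt0r_neq0 rx.
by case: fy; apply; [move/(mulfI rx0) : ea | move/(mulfI rx0) : eb].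
Qed.

End EigenfunctionConstant.

(** * Weak mixing of an upper probability and its core *)

Section CapacityWeakMixing.
Context {R : realType} d (X : measurableType d) (V : set X -> R) (T : X -> X).
Hypotheses (HV : upper_probability V) (mT : measurable_fun setT T)
  (HVT : cap_T_invariant T V).

Lemma upper_probability_ge0 A : measurable A -> 0 <= V A.
Proof. by case: HV => -[V0 [_ Vle]] _ mA; rewrite -V0; exact: Vle. Qed.

Lemma upper_probability_le A B : measurable A -> measurable B -> A `<=` B ->
  V A <= V B.
Proof. by case: HV => -[_ [_ Vle]] _; exact: Vle. Qed.

Lemma upper_probability_null A B : measurable A -> measurable B -> A `<=` B ->
  V B = 0 -> V A = 0.
Proof.
move=> mA mB AB VB; apply/le_anti; rewrite upper_probability_ge0// -VB.
by rewrite upper_probability_le.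
Qed.

(** Members of the compact set defining [V] lie in the core. Questions about [V] at one set thus
    pass to a countably additive element of the core. *)
Lemma upper_probability_attained A : measurable A ->
  exists2 P : probability X R, core V (fun A => fine (P A)) & fine (P A) = V A.
Proof.
move=> mA; have [_ [L [_ LV]]] := HV; have [[P LP PA] _] := LV _ mA.
exists P => //; split; first exact: fine_prob_setT.
split; first by move=> B _; exact: fine_prob_ge0.
split; last by move=> B /LV[_]; exact.
by move=> B C mB mC /disj_set2P BC; exact: fine_probU.
Qed.

Lemma core_null (P : probability X R) A : core V (fun A => fine (P A)) ->
  measurable A -> V A = 0 -> P A = 0%E.
Proof.
move=> [_ [_ [_ PV]]] mA VA; rewrite -fine_prob//; congr EFin; apply/le_anti.
by rewrite fine_prob_ge0 -VA PV.
Qed.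

Lemma upper_probability_bigcup_null (F : (set X)^nat) :
  (forall n, measurable (F n)) -> (forall n, V (F n) = 0) ->
  V (\bigcup_n F n) = 0.
Proof.
move=> mF F0; have mU : measurable (\bigcup_n F n) by exact: bigcup_measurable.
have [P PV <-] := upper_probability_attained mU.
have : P.-negligible (\bigcup_n F n).
  by apply: negligible_bigcup => n; apply/negligibleP => //; exact: core_null.
by move/(negligibleP _ mU) => /= ->.
Qed.

Lemma upper_probabilityU_null A B : measurable A -> measurable B ->
  V A = 0 -> V B = 0 -> V (A `|` B) = 0.
Proof.
move=> mA mB VA VB; rewrite -bigcup2E; apply: upper_probability_bigcup_null.
  by case=> [|[|n]] //=; exact: measurable0.
by case=> [|[|n]] //=; case: HV => -[].
Qed.

Section WeaklyMixingCore.
Hypothesis Vwm : cap_weakly_mixing T V.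

(** The indicator of [A] is an eigenfunction for the eigenvalue 1; whether the full set on which it
    is constant meets [A] decides the case. *)
Lemma weakly_mixing_zero_one A : invariant_set T A -> V A = 0 \/ V (~` A) = 0.
Proof.
move=> [mA AT].
have [||c [B [mB [VB Bc]]]] := Vwm (f := fun x => (\1_A x : R)%:C%C) (lam := 1).
- by split; [exact: measurable_indic | exact: measurable_cst].
- exists setT; split=> //; split; first by rewrite setCT; case: HV => -[].
  by move=> x _; rewrite mul1r -[in RHS]AT !indicE; congr (_%:R%:C%C);
    congr nat_of_bool; apply/idP/idP; rewrite !inE.
have mA' := measurableC mA; have mB' := measurableC mB.
have [[x [Ax Bx]]|AB] := pselect (exists x, A x /\ B x).
  right; apply: upper_probability_null VB => // y nAy By; apply: nAy.
  have := Bc _ By; rewrite -(Bc _ Bx) !indicE (mem_set Ax) => -[].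
  by case: (boolP (y \in A)) => [/set_mem//|_] /= /eqP; rewrite eq_sym oner_eq0.
left; apply: upper_probability_null VB => // y Ay By; apply: AB.
by exists y.
Qed.

Lemma core_setC (P : set X -> R) A : core V P -> measurable A ->
  P A + P (~` A) = 1.
Proof.
move=> [P1 [_ [PU _]]] mA; rewrite -PU ?setUv//; first exact: measurableC.
by apply/disj_set2P; rewrite setICr.
Qed.

Lemma core_agree (P P' : set X -> R) A : core V P -> core V P' ->
  invariant_set T A -> P A = P' A.
Proof.
move=> cP cP' iA; have [mA _] := iA.
have null (P0 : set X -> R) B : core V P0 -> measurable B -> V B = 0 -> P0 B = 0.
  by move=> [_ [P0ge [_ P0V]]] mB VB; apply/le_anti; rewrite P0ge// -VB P0V.
have [VA|VA] := weakly_mixing_zero_one iA; first by rewrite (null P)// (null P').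
have mA' := measurableC mA.
have := core_setC cP mA; have := core_setC cP' mA.
by rewrite (null P (~` A))// (null P' (~` A))// !addr0 => -> ->.
Qed.

Lemma core_weakly_mixing (Q : probability X R) :
  (forall A, measurable A -> Q (T @^-1` A) = Q A) ->
  core V (fun A => fine (Q A)) -> prob_weakly_mixing T Q.
Proof.
move=> QT cQ; apply: prob_weakly_mixing_eigen => // f lam mf fT.
have [||c [B [mB [VB Bc]]]] := Vwm (f := f) (lam := lam) => //.
  exists setT; split=> //; split; first by rewrite setCT; case: HV => -[].
  by move=> x _; exact: fT.
exists c, (~` B); split; first exact: measurableC.
  by apply: core_null => //; exact: measurableC.
by move=> x /= fx Bx; apply: fx; exact: Bc.
Qed.

End WeaklyMixingCore.

Lemma cmeasurable_neq (f : X -> R[i]) c : cmeasurable f ->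
  measurable [set x | f x <> c].
Proof.
move=> [mRe mIm].
have m1 (g : X -> R) r : measurable_fun setT g -> measurable [set x | g x = r].
  by move=> mg; rewrite -[X in measurable X]setTI; exact: (mg measurableT [set r]).
rewrite (_ : [set x | _] = ~` ([set x | complex.Re (f x) = complex.Re c] `&`
                            [set x | complex.Im (f x) = complex.Im c])).
  by apply/measurableC/measurableI; exact: m1.
apply/seteqP; split => x /=; first by move=> + [h1 h2]; apply; apply/eqP;
  rewrite eq_complex h1 h2 !eqxx.
by move=> h fx; apply: h; rewrite fx.
Qed.

Lemma weakly_mixing_of_core (Q : probability X R) : prob_weakly_mixing T Q ->
  core V (fun A => fine (Q A)) ->
  (forall P, core V P -> forall A, invariant_set T A -> P A = fine (Q A)) ->
  cap_weakly_mixing T V.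
Proof.
move=> Qwm cQ agree f lam mf [A [mA [VA fA]]].
have mE c := cmeasurable_neq c mf.
have as_cst c : V [set x | f x <> c] = 0 -> exists c, cap_as V (fun x => f x = c).
  move=> Vc; exists c, (~` [set x | f x <> c]); split; first exact: measurableC.
  by rewrite setCK; split => // x /= /contrapT.
have mA' := measurableC mA.
(* For [lam = 0] the hypothesis makes [f] vanish after [T], and invariance of [V] transfers this to
   [f]. *)
have [lam0|lam0] := eqVneq lam 0.
  apply: (as_cst 0); rewrite -HVT//; apply: upper_probability_null VA => //.
    exact: (measurable_preimage_iter mT 1).
  by move=> x /= fTx Ax; apply: fTx; rewrite fA// lam0 mul0r.
(* The exceptional set is enlarged to all points whose orbit meets it: still [V]-null, with
   complement stable under [T]. *)
pose N := ever T (~` A).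
have mN : measurable N by exact: measurable_ever.
have VN : V N = 0.
  apply: upper_probability_bigcup_null => k; first exact: measurable_preimage_iter.
  by rewrite cap_T_invariant_iter.
have NT x : ~ N x -> ~ N (T x) by move=> nNx /ever_preimage.
have fT x : ~ N x -> f (T x) = lam * f x.
  by move=> nNx; apply: fA; apply: contrapT => nA; apply: nNx; exact: sub_ever.
have nN : Q.-negligible N by apply/negligibleP => //; exact: core_null.
have [|||a [b ab]] := eigenfunction_cst mT Qwm mf.1 mf.2 nN NT
    (s := complex.Re lam) (t := complex.Im lam).
- by move: lam0; rewrite eq_complex /= negb_and.
- by move=> x /fT ->; case: (lam) (f x) => ? ? [].
- by move=> x /fT ->; case: (lam) (f x) => ? ? [].
pose c := (a +i* b)%C; have {}ab : Q.-negligible [set x | f x <> c].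
  apply: negligibleS ab => x /= fx; apply: contrapT => /not_orP[/contrapT h1 /contrapT h2].
  by apply: fx; rewrite /c -h1 -h2; case: (f x).
(* Some point off [N] has [f x = c = f (T x)], since the exceptions are [Q]-null. *)
have c_lam : c <> 0 -> lam = 1.
  move=> c0.
  have nT : Q.-negligible (T @^-1` [set x | f x <> c]).
    apply/negligibleP; first exact: (measurable_preimage_iter mT 1).
    by rewrite /= Qwm.1//; apply/(negligibleP _ (mE c)).
  have [x nx] := negligible_exists (negligibleU nN (negligibleU ab nT)).
  have nNx : ~ N x by move=> h; apply: nx; left.
  have fx : f x = c by apply: contrapT => h; apply: nx; right; left.
  have fTx : f (T x) = c by apply: contrapT => h; apply: nx; right; right.
  by move/eqP : c0 => c0; apply: (mulIf c0); rewrite mul1r -{1}fx -fT.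
pose E := [set x | f x <> c].
have ET x : ~ N x -> (E (T x) <-> E x).
  move=> /fT fTx; rewrite /E /= fTx; split=> h fx; apply: h.
    rewrite fx; have [->|/eqP/c_lam ->] := eqVneq c 0; first by rewrite mulr0.
    by rewrite mul1r.
  move: fx; have [->|/eqP/c_lam ->] := eqVneq c 0; last by rewrite mul1r.
  by move/eqP; rewrite mulf_eq0 (negbTE lam0) => /eqP.
pose I := inf_often T E.
have iI : invariant_set T I := inf_often_invariant mT (mE c).
have [mI _] := iI.
(* The set is strictly invariant and [Q]-null; a core element attaining [V] on it agrees there with
   [Q]. *)
have VI : V I = 0.
  have [P cP <-] := upper_probability_attained mI; rewrite (agree _ cP)//.
  suff : Q.-negligible I by move/(negligibleP _ mI) => /= ->.
  apply: negligibleS (negligibleU nN ab) => x Ix.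
  have [Nx|nNx] := pselect (N x); [by left | right].
  exact/(inf_oftenE NT ET nNx).
apply: (as_cst c); apply: (@upper_probability_null _ (N `|` I)) => //.
- exact: measurableU.
- move=> x Ex; have [Nx|nNx] := pselect (N x); [by left | right].
  exact/(inf_oftenE NT ET nNx).
- exact: upper_probabilityU_null.
Qed.

End CapacityWeakMixing.

Theorem lemma5p3 (d : measure_display) (Omega : measurableType d) (R : realType)
  (T : Omega -> Omega) (mT : measurable_fun setT T)
  (V : set Omega -> R) (HV : upper_probability V) (HVT : cap_T_invariant T V) :
  let good (Q : probability Omega R) :=
    [/\ prob_weakly_mixing T Q,
        core V (fun A => fine (Q A)) &
        forall P, core V P -> forall A, invariant_set T A -> P A = fine (Q A)] in
  (cap_weakly_mixing T V <-> exists Q : probability Omega R, good Q) /\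
  (forall Q1 Q2 : probability Omega R, good Q1 -> good Q2 ->
     forall A, measurable A -> Q1 A = Q2 A).
Proof.
move=> good; split; last first.
  move=> Q1 Q2 [[Q1T _] _ agree1] [[Q2T _] cQ2 _]; apply: (invariant_prob_unique mT) => //.
  move=> A iA; have [mA _] := iA.
  by rewrite -(fine_prob Q1 mA) -(fine_prob Q2 mA) (agree1 _ cQ2).
split=> [Vwm|[Q [Qwm cQ agree]]]; last exact: (weakly_mixing_of_core HV mT HVT Qwm).
have [Q [QT cQ]] := invariant_core HV mT HVT.
exists Q; split => //.
- exact: (core_weakly_mixing HV mT Vwm).
- by move=> P cP A iA; exact: (core_agree HV Vwm cP cQ iA).
Qed.
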